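(* The isometry group of Gödel's universe operates on the boundary $\mathcal B=[-1,1]\times\,]0,\infty[\,\times\,\mathbb R$ of light rays: the image by an isometry of a lightlike geodesic with impact parameter $(\ell,\varrho,Y)$ is a lightlike geodesic whose impact parameter depends only on the isometry and on $(\ell,\varrho,Y)$. Precisely: 1) The translation $(t,x,y,z)\mapsto(t+t_0,x,y+y_0,z+z_0)$ changes $(\ell,\varrho,Y)$ into $(\ell,\varrho,Y+y_0)$. 2) The hyperbolic dilatation $(t,x,y,z)\mapsto(t,x+x_0,y\,e^{-\sqrt2\,\omega x_0},z)$ changes $(\ell,\varrho,Y)$ into $(\ell,\varrho\,e^{\sqrt2\,\omega x_0},Y e^{-\sqrt2\,\omega x_0})$. 3) The rotational symmetry $(u,r,\phi,z)\mapsto(u,r,\phi+\phi_0,z)$ changes $(\ell,\varrho,Y)$ into $$\left(\ell,\ \ \alpha+(\varrho-\alpha)\cos(\omega\phi_0)-\omega\varrho Y\sin(\omega\phi_0),\ \ \frac{\omega\varrho Y\cos(\omega\phi_0)+(\varrho-\alpha)\sin(\omega\phi_0)}{\omega\big[\alpha+(\varrho-\alpha)\cos(\omega\phi_0)-\omega\varrho Y\sin(\omega\phi_0)\big]}\right),$$ where $\alpha:=\dfrac{2a\cosh(2r)-\sinh^2(2r)\,\dot\phi}{\dot u+2\sinh^2 r\,\dot\phi}$ is constant under $\phi\mapsto\phi+\phi_0$ and along each (lightlike) geodesic; indeed $$\alpha=\frac\varrho2\,(1+\omega^2Y^2)+\frac{1+\ell^2}{\varrho}.$$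
   Context: Fix $\omega>0$. Gödel's universe is $\mathbb R^4$ with coordinates $(t,x,y,z)$ and the pseudo-metric $$ds^2=dt^2-dx^2+\tfrac12 e^{2\sqrt2\,\omega x}dy^2+2e^{\sqrt2\,\omega x}dt\,dy-dz^2 .$$ Another coordinate system $(u,r,\phi,z)\in\mathbb R\times\mathbb R_+\times(\mathbb R/\frac{2\pi}{\omega}\mathbb Z)\times\mathbb R$ is defined by $|t-u|<\pi/\omega$ and $$e^{\sqrt2\omega x}=\cosh(2r)+\sinh(2r)\cos(\omega\phi),\quad e^{\sqrt2\omega x}\,\omega y=\sinh(2r)\sin(\omega\phi),\quad \tan\big[\tfrac\omega2(\phi+t-u)\big]=e^{-2r}\tan\big[\tfrac{\omega\phi}{2}\big],$$ in which $ds^2=[du+2\sinh^2r\,d\phi]^2-2\omega^{-2}dr^2-\frac12\sinh^2(2r)\,d\phi^2-dz^2$. The isometry group of Gödel's universe is the five-dimensional Lie group generated by the translations, hyperbolic dilatations and rotational symmetries listed in 1), 2), 3). Along a (non-constant) lightlike geodesic with affine parameter, the quantities $a=\dot t+e^{\sqrt2\omega x}\dot y=\dot u+2\sinh^2r\,\dot\phi$, $b=e^{\sqrt2\omega x}(2\dot t+e^{\sqrt2\omega x}\dot y)$, $c=\dot z$ and $Y=y+\frac{\sqrt2\,\dot x}{\omega b}$ are constant, with $ab>0$, $c^2\le a^2$. Its impact parameter is $(\ell,\varrho,Y):=(c/a,b/a,Y)\in\mathcal B$. A light ray is an equivalence class of lightlike geodesics having the same impact parameter; the set of light rays is identified with $\mathcal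 B$, called the boundary. *)

(* Defs.v *)
From Stdlib Require Import Reals Lra FunctionalExtensionality.
From Coquelicot Require Import Coquelicot.
Open Scope R_scope.

(** * Goedel's universe *)

Record point : Type := Pt { pt_t : R; pt_x : R; pt_y : R; pt_z : R }.

Inductive index : Type := It | Ix | Iy | Iz.

Definition coord (i : index) (p : point) : R :=
  match i with It => pt_t p | Ix => pt_x p | Iy => pt_y p | Iz => pt_z p end.

Definition upd (i : index) (p : point) (v : R) : point :=
  match i with
  | It => Pt v (pt_x p) (pt_y p) (pt_z p)
  | Ix => Pt (pt_t p) v (pt_y p) (pt_z p)
  | Iy => Pt (pt_t p) (pt_x p) v (pt_z p)
  | Iz => Pt (pt_t p) (pt_x p) (pt_y p) v
  end.

Definition sum_index (f : index -> R) : R := f It + f Ix + f Iy + f Iz.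

Definition partial (i : index) (f : point -> R) (p : point) : R :=
  Derive (fun v => f (upd i p v)) (coord i p).

Definition expx (omega : R) (p : point) : R := exp (sqrt 2 * omega * pt_x p).

(** The matrix of [dt^2 - dx^2 + (1/2) E^2 dy^2 + 2 E dt dy - dz^2],
    where [E = exp (sqrt 2 * omega * x)]. *)
Definition metric (omega : R) (i j : index) (p : point) : R :=
  match i, j with
  | It, It => 1
  | Ix, Ix => -1
  | Iy, Iy => / 2 * exp (2 * sqrt 2 * omega * pt_x p)
  | It, Iy | Iy, It => expx omega p
  | Iz, Iz => -1
  | _, _ => 0
  end.

Definition inv_metric (omega : R) (i j : index) (p : point) : R :=
  match i, j with
  | It, It => -1
  | Ix, Ix => -1
  | Iy, Iy => -2 / exp (2 * sqrt 2 * omega * pt_x p)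
  | It, Iy | Iy, It => 2 / expx omega p
  | Iz, Iz => -1
  | _, _ => 0
  end.

Lemma expx_sqr (omega : R) (p : point) :
  exp (2 * sqrt 2 * omega * pt_x p) = expx omega p * expx omega p.
Proof. unfold expx; rewrite <- exp_plus; f_equal; ring. Qed.

Lemma inv_metricP (omega : R) (p : point) (i k : index) :
  sum_index (fun j => inv_metric omega i j p * metric omega j k p) =
  match i, k with
  | It, It | Ix, Ix | Iy, Iy | Iz, Iz => 1
  | _, _ => 0
  end.
Proof.
assert (HE : expx omega p <> 0) by (apply Rgt_not_eq, exp_pos).
destruct i, k; unfold sum_index, inv_metric, metric; rewrite ?expx_sqr;
  field; exact HE.
Qed.

(** [christoffel omega k i j] is the symbol with upper index [k] of the
    Levi-Civita connection. *)
Definition christoffel (omega : R) (k i j : index) (p : point) : R :=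
  / 2 * sum_index (fun l => inv_metric omega k l p *
    (partial i (metric omega j l) p + partial j (metric omega i l) p
     - partial l (metric omega i j) p)).

(** * Geodesics *)

(** A curve is given by a total function [R -> point]; only its values on the
    open interval [(lo, hi)], possibly unbounded, are relevant. *)
Definition in_itv (lo hi : Rbar) (s : R) : Prop := Rbar_lt lo s /\ Rbar_lt s hi.

Definition vel (gamma : R -> point) (i : index) (s : R) : R :=
  Derive (fun s' => coord i (gamma s')) s.

Definition acc (gamma : R -> point) (i : index) (s : R) : R :=
  Derive (vel gamma i) s.

Definition geodesic (omega : R) (lo hi : Rbar) (gamma : R -> point) : Prop :=
  Rbar_lt lo hi /\
  forall s, in_itv lo hi s ->
    (forall i, ex_derive (fun s' => coord i (gamma s')) s /\
               ex_derive (vel gamma i) s) /\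
    (forall k, acc gamma k s +
       sum_index (fun i => sum_index (fun j =>
         christoffel omega k i j (gamma s) * vel gamma i s * vel gamma j s)) = 0).

Definition lightlike_geodesic
    (omega : R) (lo hi : Rbar) (gamma : R -> point) : Prop :=
  geodesic omega lo hi gamma /\
  (forall s, in_itv lo hi s ->
     sum_index (fun i => sum_index (fun j =>
       metric omega i j (gamma s) * vel gamma i s * vel gamma j s)) = 0) /\
  (exists s1 s2, in_itv lo hi s1 /\ in_itv lo hi s2 /\ gamma s1 <> gamma s2).

(** * Impact parameter *)

Definition const_a (omega : R) (gamma : R -> point) (s : R) : R :=
  vel gamma It s + expx omega (gamma s) * vel gamma Iy s.

Definition const_b (omega : R) (gamma : R -> point) (s : R) : R :=
  expx omega (gamma s) *
    (2 * vel gamma It s + expx omega (gamma s) * vel gamma Iy s).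

Definition const_c (gamma : R -> point) (s : R) : R := vel gamma Iz s.

Definition const_Y (omega : R) (gamma : R -> point) (s : R) : R :=
  pt_y (gamma s) + sqrt 2 * vel gamma Ix s / (omega * const_b omega gamma s).

Definition impact_parameter (omega : R) (lo hi : Rbar) (gamma : R -> point)
    (beta : R * R * R) : Prop :=
  forall s, in_itv lo hi s ->
    beta = (const_c gamma s / const_a omega gamma s,
            const_b omega gamma s / const_a omega gamma s,
            const_Y omega gamma s).

Definition boundary (beta : R * R * R) : Prop :=
  let '(l, rho, Y) := beta in -1 <= l <= 1 /\ 0 < rho.

(** * Cylindrical coordinates *)

(** [phi] is a real representative of a class modulo [2 * PI / omega].  The
    equation between tangents is meant in the projective line: both sides may
    be infinite.  On the axis [r = 0] every [phi] is admissible. *)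
Definition polar_coords (omega u r phi z : R) (p : point) : Prop :=
  let A := omega / 2 * (phi + pt_t p - u) in
  let B := omega * phi / 2 in
  0 <= r /\
  Rabs (pt_t p - u) < PI / omega /\
  expx omega p = cosh (2 * r) + sinh (2 * r) * cos (omega * phi) /\
  expx omega p * (omega * pt_y p) = sinh (2 * r) * sin (omega * phi) /\
  ((cos A = 0 /\ cos B = 0) \/
   (cos A <> 0 /\ cos B <> 0 /\ tan A = exp (- (2 * r)) * tan B)) /\
  z = pt_z p.

(** * Isometries *)

Definition translation (t0 y0 z0 : R) (p : point) : point :=
  Pt (pt_t p + t0) (pt_x p) (pt_y p + y0) (pt_z p + z0).

Definition dilatation (omega x0 : R) (p : point) : point :=
  Pt (pt_t p) (pt_x p + x0) (pt_y p * exp (- (sqrt 2 * omega * x0))) (pt_z p).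

(** [F] reads [(u, r, phi, z) |-> (u, r, phi + phi0, z)]; see
    [is_rotation_exists_unique] below. *)
Definition is_rotation (omega phi0 : R) (F : point -> point) : Prop :=
  forall u r phi z p,
    polar_coords omega u r phi z p ->
    polar_coords omega u r (phi + phi0) z (F p).

(** The group of transformations generated by the translations, the hyperbolic
    dilatations and the rotational symmetries. *)
Inductive isometry_group (omega : R) : (point -> point) -> Prop :=
| iso_translation t0 y0 z0 : isometry_group omega (translation t0 y0 z0)
| iso_dilatation x0 : isometry_group omega (dilatation omega x0)
| iso_rotation phi0 F : is_rotation omega phi0 F -> isometry_group omega F
| iso_id : isometry_group omega (fun p => p)
| iso_comp F G : isometry_group omega F -> isometry_group omega G ->
    isometry_group omega (fun p => F (G p))
| iso_inv F G : isometry_group omega F ->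
    (forall p, F (G p) = p) -> (forall p, G (F p) = p) ->
    isometry_group omega G.

(** * The invariant alpha *)

(** [u], [r], [phi] are cylindrical coordinates along [gamma] near [s]. *)
Definition polar_lift_at (omega : R) (gamma : R -> point) (u r phi : R -> R)
    (s : R) : Prop :=
  locally s (fun s' =>
    polar_coords omega (u s') (r s') (phi s') (pt_z (gamma s')) (gamma s')) /\
  ex_derive u s /\ ex_derive r s /\ ex_derive phi s.

Definition alpha (omega : R) (gamma : R -> point) (u r phi : R -> R) (s : R) : R :=
  (2 * const_a omega gamma s * cosh (2 * r s) - sinh (2 * r s) ^ 2 * Derive phi s)
  / (Derive u s + 2 * sinh (r s) ^ 2 * Derive phi s).

Definition boundary_alpha (omega l rho Y : R) : R :=
  rho / 2 * (1 + omega ^ 2 * Y ^ 2) + (1 + l ^ 2) / rho.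

(** * Existence and uniqueness of the rotational symmetries *)

Definition radial_cosh (E eta : R) : R := (E + / E + eta ^ 2 / E) / 2.

Lemma expx_pos omega p : 0 < expx omega p.
Proof. apply exp_pos. Qed.

Lemma polar_tan_iff (d h k : R) : - (PI / 2) < d < PI / 2 -> 0 < k ->
  ((cos (h + d) = 0 /\ cos h = 0) \/
   (cos (h + d) <> 0 /\ cos h <> 0 /\ tan (h + d) = k * tan h)) <->
  tan d * (cos h ^ 2 + k * sin h ^ 2) = (k - 1) * (sin h * cos h).
Proof.
intros Hd Hk.
assert (Hcd : 0 < cos d) by (apply cos_gt_0; lra).
assert (Hsc := sin2_cos2 h); unfold Rsqr in Hsc.
assert (Hprod : tan d * (cos h ^ 2 + k * sin h ^ 2) = (k - 1) * (sin h * cos h) <->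
   sin (h + d) * cos h = k * sin h * cos (h + d)).
{ rewrite sin_plus, cos_plus; unfold tan.
  assert (Hf : sin d / cos d * (cos h ^ 2 + k * sin h ^ 2) -
     (k - 1) * (sin h * cos h) =
     ((sin h * cos d + cos h * sin d) * cos h -
     k * sin h * (cos h * cos d - sin h * sin d)) / cos d) by (field; lra).
  split; intros H.
  - assert (H0 : ((sin h * cos d + cos h * sin d) * cos h -
      k * sin h * (cos h * cos d - sin h * sin d)) / cos d = 0) by lra.
    apply (f_equal (fun v => v * cos d)) in H0.
    unfold Rdiv in H0; rewrite Rmult_assoc, Rinv_l in H0; lra.
  - rewrite H in Hf; unfold Rdiv in Hf. lra. }
rewrite Hprod; unfold tan; split.
- intros [[H1 H2]|[H1 [H2 H3]]].
  + rewrite H1, H2; ring.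
  + assert (H4 : sin (h + d) = sin (h + d) / cos (h + d) * cos (h + d)) by (field; auto).
    rewrite H4, H3; field; auto.
- intros H.
  destruct (Req_dec (cos h) 0) as [Hh|Hh].
  + left; split; auto.
    rewrite Hh in H, Hsc.
    assert (sin h <> 0) by (intros Hs; rewrite Hs in Hsc; lra).
    destruct (Req_dec (cos (h + d)) 0) as [|Hn]; auto.
    exfalso; apply (Rmult_integral_contrapositive_currified (k * sin h) (cos (h + d))); auto;
      [apply Rmult_integral_contrapositive_currified; auto; lra | lra].
  + right; assert (cos (h + d) <> 0).
    { intros Hn; rewrite Hn in H.
      assert (Hs := sin2_cos2 (h + d)); unfold Rsqr in Hs; rewrite Hn in Hs.
      assert (sin (h + d) = 0) by (destruct (Rmult_integral (sin (h + d)) (cos h)); auto; lra).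
      rewrite H0 in Hs; lra. }
    repeat split; auto.
    apply (Rmult_eq_reg_r (cos (h + d) * cos h)).
    * field_simplify; auto; lra.
    * apply Rmult_integral_contrapositive_currified; auto.
Qed.

Lemma polar_coordsP omega u r phi z p : 0 < omega ->
  polar_coords omega u r phi z p <->
  0 <= r /\
  expx omega p = cosh (2 * r) + sinh (2 * r) * cos (omega * phi) /\
  expx omega p * (omega * pt_y p) = sinh (2 * r) * sin (omega * phi) /\
  pt_t p = u - 2 / omega *
    atan (expx omega p * (omega * pt_y p) / (1 + expx omega p)) /\
  z = pt_z p.
Proof.
intros Hw; unfold polar_coords.
set (E := expx omega p); set (eta := E * (omega * pt_y p)).
set (d := omega / 2 * (pt_t p - u)).
set (h := omega * phi / 2); set (k := exp (- (2 * r))).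
assert (HE : 0 < E) by apply expx_pos.
assert (Hk : 0 < k) by apply exp_pos.
replace (omega / 2 * (phi + pt_t p - u)) with (h + d) by (unfold h, d; field).
assert (Hab : Rabs (pt_t p - u) < PI / omega <-> - (PI / 2) < d < PI / 2).
{ assert (Hd : pt_t p - u = 2 / omega * d) by (unfold d; field; lra).
  assert (Hpi : PI / omega = 2 / omega * (PI / 2)) by (field; lra).
  assert (H2 : 0 < 2 / omega) by (apply Rdiv_lt_0_compat; lra).
  rewrite Hd, Hpi; split.
  - intros H; apply Rabs_def2 in H; destruct H as [H3 H4].
    apply Rmult_lt_reg_l in H3; auto.
    rewrite Ropp_mult_distr_r in H4; apply Rmult_lt_reg_l in H4; auto; lra.
  - intros [H3 H4]; apply Rabs_def1.
    + apply Rmult_lt_compat_l; auto.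
    + rewrite Ropp_mult_distr_r; apply Rmult_lt_compat_l; auto; lra. }
assert (Ht : pt_t p = u - 2 / omega * atan (eta / (1 + E)) <-> d = - atan (eta / (1 + E))).
{ unfold d; split; intros H.
  - rewrite H; field; lra.
  - replace (atan (eta / (1 + E))) with (- (omega / 2 * (pt_t p - u))) by lra.
    field; lra. }
rewrite Ht, Hab.
assert (Hkey : E = cosh (2 * r) + sinh (2 * r) * cos (omega * phi) ->
  eta = sinh (2 * r) * sin (omega * phi) ->
  (k - 1) * (sin h * cos h) = - (eta / (1 + E)) * (cos h ^ 2 + k * sin h ^ 2)).
{ intros H1 H2.
  assert (Hsc := sin2_cos2 h); unfold Rsqr in Hsc.
  assert (Hc : cosh (2 * r) = (/ k + k) / 2)
    by (unfold cosh, k; rewrite <- exp_Ropp, Ropp_involutive; lra).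
  assert (Hs : sinh (2 * r) = (/ k - k) / 2)
    by (unfold sinh, k; rewrite <- exp_Ropp, Ropp_involutive; lra).
  assert (Hth : omega * phi = 2 * h) by (unfold h; field).
  rewrite Hth, sin_2a in H2; rewrite Hth, cos_2a in H1; rewrite Hc, Hs in H1; rewrite Hs in H2.
  assert (HP : 1 + E = (1 + k) / k * (cos h ^ 2 + k * sin h ^ 2)).
  { assert (Hone : 1 + E = (cos h ^ 2 + sin h ^ 2) + (/ k + k) / 2 * (cos h ^ 2 + sin h ^ 2)
       + (/ k - k) / 2 * (cos h * cos h - sin h * sin h)).
    { rewrite H1. replace (cos h ^ 2 + sin h ^ 2) with 1 by lra. ring. }
    rewrite Hone; field; lra. }
  assert (HQ : 0 < cos h ^ 2 + k * sin h ^ 2).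
  { destruct (Req_dec (cos h) 0) as [Hz|Hz].
    - rewrite Hz in *.
      assert (sin h ^ 2 = 1) by lra. rewrite H. lra.
    - assert (0 < cos h ^ 2) by (apply pow2_gt_0; auto).
      assert (0 <= k * sin h ^ 2) by (apply Rmult_le_pos; [lra | apply pow2_ge_0]).
      lra. }
  rewrite HP, H2; field; repeat split; lra. }
assert (HQ : 0 < cos h ^ 2 + k * sin h ^ 2).
{ assert (Hsc := sin2_cos2 h); unfold Rsqr in Hsc.
  destruct (Req_dec (cos h) 0) as [Hz|Hz].
  - rewrite Hz in *. assert (sin h ^ 2 = 1) by lra. rewrite H. lra.
  - assert (0 < cos h ^ 2) by (apply pow2_gt_0; auto).
    assert (0 <= k * sin h ^ 2) by (apply Rmult_le_pos; [lra | apply pow2_ge_0]).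
    lra. }
split.
- intros (H0 & H1 & H2 & H3 & H4 & H5); repeat split; auto.
  apply polar_tan_iff in H4; auto.
  rewrite (Hkey H2 H3) in H4; apply Rmult_eq_reg_r in H4; [|lra].
  rewrite <- atan_opp, <- H4; symmetry; apply atan_tan; lra.
- intros (H0 & H2 & H3 & H4 & H5).
  assert (Hd : - (PI / 2) < d < PI / 2).
  { rewrite H4, <- atan_opp; destruct (atan_bound (- (eta / (1 + E)))); lra. }
  repeat split; auto; try tauto.
  apply polar_tan_iff; auto.
  rewrite (Hkey H2 H3), H4, <- atan_opp, tan_atan; reflexivity.
Qed.

Lemma polar_coords_inj omega u r phi z p q : 0 < omega ->
  polar_coords omega u r phi z p -> polar_coords omega u r phi z q -> p = q.
Proof.
intros Hw Hp Hq; apply polar_coordsP in Hp; apply polar_coordsP in Hq; auto.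
destruct Hp as (_ & E1 & Y1 & T1 & Z1), Hq as (_ & E2 & Y2 & T2 & Z2).
assert (HE : expx omega p = expx omega q) by congruence.
assert (HX : pt_x p = pt_x q).
{ apply exp_inv in HE; apply Rmult_eq_reg_l in HE; auto.
  assert (0 < sqrt 2) by (apply sqrt_lt_R0; lra).
  apply Rmult_integral_contrapositive_currified; lra. }
assert (HY : pt_y p = pt_y q).
{ rewrite <- Y2, HE in Y1; apply Rmult_eq_reg_l in Y1.
  - apply Rmult_eq_reg_l in Y1; auto; lra.
  - apply Rgt_not_eq, expx_pos. }
rewrite HE, HY in T1.
destruct p, q; simpl in *; congruence.
Qed.

Lemma exists_angle (a b : R) : a ^ 2 + b ^ 2 = 1 -> exists th, cos th = a /\ sin th = b.
Proof.
intros H.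
assert (Ha : -1 <= a <= 1) by nra.
assert (Hs := sin2_cos2 (acos a)); unfold Rsqr in Hs; rewrite cos_acos in Hs; auto.
assert (Hb : (sin (acos a) - b) * (sin (acos a) + b) = 0) by nra.
destruct (Rmult_integral _ _ Hb).
- exists (acos a); rewrite cos_acos; auto; split; lra.
- exists (- acos a); rewrite cos_neg, sin_neg, cos_acos; auto; split; lra.
Qed.

Lemma exists_radius (C : R) : 1 <= C -> exists r, 0 <= r /\ cosh (2 * r) = C.
Proof.
intros HC.
assert (Hsq : sqrt (C ^ 2 - 1) * sqrt (C ^ 2 - 1) = C ^ 2 - 1) by (apply sqrt_sqrt; nra).
assert (Hp := sqrt_pos (C ^ 2 - 1)).
set (w := sqrt (C ^ 2 - 1)) in *.
exists (ln (C + w) / 2); split.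
- assert (0 <= ln (C + w)); [|lra].
  rewrite <- ln_1; destruct (Req_dec (C + w) 1) as [->|]; [lra|].
  left; apply ln_increasing; lra.
- unfold cosh; replace (2 * (ln (C + w) / 2)) with (ln (C + w)) by field.
  rewrite exp_Ropp, exp_ln by lra.
  replace (/ (C + w)) with (C - w); [field|].
  apply (Rmult_eq_reg_r (C + w)); [|lra].
  rewrite Rinv_l by lra; nra.
Qed.

Lemma cosh2_sinh2 x : cosh x ^ 2 - sinh x ^ 2 = 1.
Proof.
unfold cosh, sinh.
assert (H : exp x * exp (- x) = 1) by (rewrite <- exp_plus, Rplus_opp_r; apply exp_0).
nra.
Qed.

Lemma sinh_ge_0 x : 0 <= x -> 0 <= sinh x.
Proof.
intros H; unfold sinh.
assert (exp (- x) <= exp x); [|lra].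
destruct (Req_dec x 0) as [->|]; [rewrite Ropp_0; lra|].
left; apply exp_increasing; lra.
Qed.

Lemma radial_coshE E eta : 0 < E ->
  radial_cosh E eta ^ 2 - 1 = (E - radial_cosh E eta) ^ 2 + eta ^ 2.
Proof. intros H; unfold radial_cosh; field; lra. Qed.

Lemma radial_cosh_ge1 E eta : 0 < E -> 1 <= radial_cosh E eta.
Proof.
intros H; unfold radial_cosh.
assert (H1 : (E + / E + eta ^ 2 / E) / 2 - 1 = ((E - 1) ^ 2 + eta ^ 2) * / (2 * E))
  by (field; lra).
assert (0 < / (2 * E)) by (apply Rinv_0_lt_compat; lra).
assert (0 <= ((E - 1) ^ 2 + eta ^ 2) * / (2 * E)); [|lra].
apply Rmult_le_pos; [|lra].
assert (H2 := pow2_ge_0 (E - 1)); assert (H3 := pow2_ge_0 eta); lra.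
Qed.

Lemma polar_coords_exist omega p : 0 < omega ->
  exists u r phi, polar_coords omega u r phi (pt_z p) p.
Proof.
intros Hw.
set (E := expx omega p); set (eta := E * (omega * pt_y p)).
assert (HE : 0 < E) by apply expx_pos.
assert (HC := radial_cosh_ge1 E eta HE); assert (HCE := radial_coshE E eta HE).
set (C := radial_cosh E eta) in *.
destruct (exists_radius C HC) as [r [Hr HrC]].
assert (Hcs := cosh2_sinh2 (2 * r)); rewrite HrC in Hcs.
assert (Hs : 0 <= sinh (2 * r)) by (apply sinh_ge_0; lra).
set (S := sinh (2 * r)) in *.
assert (Hth : exists th, E - C = S * cos th /\ eta = S * sin th).
{ destruct (Req_dec S 0) as [HS|HS].
  - exists 0; rewrite HS in *.
    assert (H1 := pow2_ge_0 (E - C)); assert (H2 := pow2_ge_0 eta).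
    split; rewrite Rmult_0_l; apply Rsqr_0_uniq; unfold Rsqr; nra.
  - destruct (exists_angle ((E - C) / S) (eta / S)) as [th [H1 H2]].
    + replace (((E - C) / S) ^ 2 + (eta / S) ^ 2)
        with (((E - C) ^ 2 + eta ^ 2) / S ^ 2) by (field; auto).
      rewrite <- HCE; replace (C ^ 2 - 1) with (S ^ 2) by lra; field; auto.
    + exists th; rewrite H1, H2; split; field; auto. }
destruct Hth as [th [H1 H2]].
exists (pt_t p + 2 / omega * atan (eta / (1 + E))), r, (th / omega).
apply polar_coordsP; auto.
replace (omega * (th / omega)) with th by (field; lra).
rewrite HrC; fold E; fold eta; fold S; repeat split; auto; lra.
Qed.

Definition rotation (omega phi0 : R) (p : point) : point :=
  let E := expx omega p in
  let eta := E * (omega * pt_y p) in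
  let C := radial_cosh E eta in
  let E' := C + (E - C) * cos (omega * phi0) - eta * sin (omega * phi0) in
  let eta' := (E - C) * sin (omega * phi0) + eta * cos (omega * phi0) in
  Pt (pt_t p + 2 / omega * atan (eta / (1 + E)) - 2 / omega * atan (eta' / (1 + E')))
     (ln E' / (sqrt 2 * omega)) (eta' / (omega * E')) (pt_z p).

Lemma rotation_is_rotation omega phi0 : 0 < omega ->
  is_rotation omega phi0 (rotation omega phi0).
Proof.
intros Hw u r phi z p Hp; apply polar_coordsP in Hp; auto.
destruct Hp as (Hr & H1 & H2 & Ht & Hz).
apply polar_coordsP; auto; unfold rotation.
set (E := expx omega p) in *; set (eta := E * (omega * pt_y p)) in *.
assert (HE : 0 < E) by apply expx_pos.
assert (HC : radial_cosh E eta = cosh (2 * r)).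
{ assert (Hcs := cosh2_sinh2 (2 * r)).
  assert (Hsc := sin2_cos2 (omega * phi)); unfold Rsqr in Hsc.
  assert (Hm : E ^ 2 + 1 + eta ^ 2 = 2 * E * cosh (2 * r)).
  { set (c := cosh (2 * r)) in *; set (s := sinh (2 * r)) in *.
    set (co := cos (omega * phi)) in *; set (si := sin (omega * phi)) in *.
    rewrite H1, H2.
    replace ((c + s * co) ^ 2 + 1 + (s * si) ^ 2)
      with (c ^ 2 + 2 * c * s * co + s ^ 2 * (si * si + co * co) + 1) by ring.
    rewrite Hsc; replace (s ^ 2) with (c ^ 2 - 1) by lra; ring. }
  unfold radial_cosh.
  replace ((E + / E + eta ^ 2 / E) / 2) with ((E ^ 2 + 1 + eta ^ 2) / (2 * E)) by (field; lra).
  rewrite Hm; field; lra. }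
rewrite HC.
set (E' := _ - eta * sin _); set (eta' := _ + eta * cos _).
assert (HE' : E' = cosh (2 * r) + sinh (2 * r) * cos (omega * (phi + phi0))).
{ unfold E'; rewrite H1, H2, Rmult_plus_distr_l, cos_plus; ring. }
assert (Heta' : eta' = sinh (2 * r) * sin (omega * (phi + phi0))).
{ unfold eta'; rewrite H1, H2, Rmult_plus_distr_l, sin_plus; ring. }
assert (Hpos : 0 < E').
{ rewrite HE'.
  assert (Hcb := COS_bound (omega * (phi + phi0))).
  assert (Hs : 0 <= sinh (2 * r)) by (apply sinh_ge_0; lra).
  assert (He : 0 < cosh (2 * r) - sinh (2 * r)).
  { unfold cosh, sinh; assert (Hx := exp_pos (- (2 * r))); lra. }
  nra. }
clearbody E' eta'.
assert (Hx : forall t y z', expx omega (Pt t (ln E' / (sqrt 2 * omega)) y z') = E').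
{ intros t y z'; unfold expx; simpl.
  assert (0 < sqrt 2) by (apply sqrt_lt_R0; lra).
  replace (sqrt 2 * omega * (ln E' / (sqrt 2 * omega))) with (ln E') by (field; lra).
  apply exp_ln; auto. }
rewrite !Hx; simpl.
replace (E' * (omega * (eta' / (omega * E')))) with eta' by (field; lra).
repeat split; auto; lra.
Qed.

Lemma is_rotation_exists_unique omega phi0 : 0 < omega ->
  exists! F, is_rotation omega phi0 F.
Proof.
intros Hw; exists (rotation omega phi0); split.
- apply rotation_is_rotation; auto.
- intros F HF; apply functional_extensionality; intros p.
  destruct (polar_coords_exist omega p Hw) as (u & r & phi & Hp).
  apply (polar_coords_inj omega u r (phi + phi0) (pt_z p)); auto.
  apply rotation_is_rotation; auto.
Qed.

(* Main.v *)
(** Besides [a] and [c], a geodesic has three constants of motion: the momenta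
    [(b, m, g)] of the Killing fields of the sl(2) summand, where
    [m = omega * b * Y].  A twice differentiable curve is a geodesic if and only
    if [a], [c], [b], [m] are constant, because the derivatives of these four
    functions are an invertible linear combination of the four geodesic
    equations; [g] is then constant as well.  The squared length of the velocity is
    [(b * g - m^2) / 2 - a^2 - c^2].

    Each isometry fixes [a] and [c] and acts on [(b, m, g)] by a linear map
    preserving [b * g - m^2], hence it maps (lightlike) geodesics to (lightlike)
    geodesics.  On a lightlike geodesic [g] is determined by [a], [b], [c], [m],
    and dividing by [a] yields the action on impact parameters.  For the
    rotations one uses that [(cosh 2r, sinh 2r cos, sinh 2r sin)] lies on a
    hyperboloid in Minkowski 3-space, on which they act linearly; there
    [alpha = (b + g) / (2 a)]. *)

Require Import Defs.
From Stdlib Require Import Reals Lra FunctionalExtensionality.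
From Coquelicot Require Import Coquelicot.
Open Scope R_scope.

(** * Calculus on open intervals *)

Lemma sqrt2_sqr : sqrt 2 * sqrt 2 = 2.
Proof. apply sqrt_sqrt; lra. Qed.

Lemma sqrt2_pos : 0 < sqrt 2.
Proof. apply sqrt_lt_R0; lra. Qed.

Lemma in_itv_locally lo hi s : in_itv lo hi s -> locally s (in_itv lo hi).
Proof.
intros [Hl Hh].
apply filter_and; [apply (open_Rbar_gt lo) | apply (open_Rbar_lt hi)]; assumption.
Qed.

Lemma in_itv_convex lo hi s1 s2 s :
  in_itv lo hi s1 -> in_itv lo hi s2 -> s1 <= s <= s2 -> in_itv lo hi s.
Proof.
intros [H1 _] [_ H2] [H3 H4]; split.
- apply (Rbar_lt_le_trans lo s1 s); auto.
- apply (Rbar_le_lt_trans s s2 hi); auto.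
Qed.

Lemma null_derivative_itv lo hi (f : R -> R) :
  (forall s, in_itv lo hi s -> is_derive f s 0) ->
  forall s1 s2, in_itv lo hi s1 -> in_itv lo hi s2 -> f s1 = f s2.
Proof.
intros Hf.
assert (Hlt : forall s1 s2, in_itv lo hi s1 -> in_itv lo hi s2 -> s1 < s2 -> f s1 = f s2).
{ intros s1 s2 H1 H2 H12; apply (eq_is_derive f s1 s2); auto.
  intros s Hs; apply Hf, (in_itv_convex lo hi s1 s2); auto. }
intros s1 s2 H1 H2; destruct (Rtotal_order s1 s2) as [H|[->|H]]; auto.
symmetry; auto.
Qed.

Lemma const_itv_derivative lo hi (f : R -> R) :
  (forall s1 s2, in_itv lo hi s1 -> in_itv lo hi s2 -> f s1 = f s2) ->
  forall s, in_itv lo hi s -> is_derive f s 0.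
Proof.
intros Hf s Hs.
apply (is_derive_ext_loc (fun _ => f s)); [|apply (is_derive_const (f s))].
apply (filter_imp (in_itv lo hi)); [|apply in_itv_locally, Hs].
intros s' Hs'; apply Hf; auto.
Qed.

(** The regularity that [geodesic] asks of each coordinate, whose [Derive] is by definition [vel].
    Continuity of the second derivative is not demanded. *)
Definition twice_on (lo hi : Rbar) (f : R -> R) : Prop :=
  forall s, in_itv lo hi s -> ex_derive f s /\ ex_derive (Derive f) s.

(** [Derive f] is known to agree with [f'] only inside the interval. The interval is open, so they
    agree near each of its points, and differentiability carries over. *)
Lemma twice_on_derive (lo hi : Rbar) (f f' : R -> R) :
  (forall s, in_itv lo hi s -> is_derive f s (f' s) /\ ex_derive f' s) ->
  twice_on lo hi f.
Proof.
intros Hf s Hs; split; [exists (f' s); apply Hf, Hs|].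
apply (ex_derive_ext_loc f'); [|apply Hf, Hs].
apply (filter_imp (in_itv lo hi)); [|apply in_itv_locally, Hs].
intros s' Hs'; symmetry; apply is_derive_unique, Hf, Hs'.
Qed.

Lemma twice_on_const (lo hi : Rbar) (c : R) : twice_on lo hi (fun _ => c).
Proof.
apply (twice_on_derive lo hi _ (fun _ => 0)); intros s _; split.
- apply (is_derive_const c).
- apply ex_derive_const.
Qed.

Lemma twice_on_plus (lo hi : Rbar) (f g : R -> R) :
  twice_on lo hi f -> twice_on lo hi g -> twice_on lo hi (fun s => f s + g s).
Proof.
intros Hf Hg; apply (twice_on_derive lo hi _ (fun s => Derive f s + Derive g s)).
intros s Hs; destruct (Hf s Hs), (Hg s Hs); split.
- apply (is_derive_plus f g); apply Derive_correct; auto.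
- apply (ex_derive_plus (Derive f) (Derive g)); auto.
Qed.

Lemma twice_on_mult (lo hi : Rbar) (f g : R -> R) :
  twice_on lo hi f -> twice_on lo hi g -> twice_on lo hi (fun s => f s * g s).
Proof.
intros Hf Hg; apply (twice_on_derive lo hi _ (fun s => Derive f s * g s + f s * Derive g s)).
intros s Hs; destruct (Hf s Hs), (Hg s Hs); split.
- apply is_derive_Reals, derivable_pt_lim_mult; apply is_derive_Reals, Derive_correct; auto.
- apply (ex_derive_plus (fun s => Derive f s * g s) (fun s => f s * Derive g s));
    apply ex_derive_mult; auto.
Qed.

Lemma twice_on_opp (lo hi : Rbar) (f : R -> R) :
  twice_on lo hi f -> twice_on lo hi (fun s => - f s).
Proof.
intros Hf s Hs.
apply (twice_on_mult lo hi (fun _ => -1) f (twice_on_const lo hi _)) in Hs as [H1 H2]; auto.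
assert (He : (fun s => -1 * f s) = (fun s => - f s))
  by (apply functional_extensionality; intros; ring).
rewrite He in H1, H2; auto.
Qed.

Lemma twice_on_minus (lo hi : Rbar) (f g : R -> R) :
  twice_on lo hi f -> twice_on lo hi g -> twice_on lo hi (fun s => f s - g s).
Proof. intros Hf Hg; apply twice_on_plus, twice_on_opp; auto. Qed.

Lemma twice_on_comp (lo hi : Rbar) (h h' f : R -> R) :
  (forall s, in_itv lo hi s -> is_derive h (f s) (h' (f s)) /\ ex_derive h' (f s)) ->
  twice_on lo hi f -> twice_on lo hi (fun s => h (f s)).
Proof.
intros Hh Hf; apply (twice_on_derive lo hi _ (fun s => Derive f s * h' (f s))).
intros s Hs; destruct (Hf s Hs), (Hh s Hs); split.
- apply (is_derive_comp h f); auto; apply Derive_correct; auto.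
- apply ex_derive_mult; auto; apply ex_derive_comp; auto.
Qed.

Lemma twice_on_exp (lo hi : Rbar) (f : R -> R) :
  twice_on lo hi f -> twice_on lo hi (fun s => exp (f s)).
Proof.
apply (twice_on_comp lo hi exp exp); intros s _; split.
- apply is_derive_exp.
- exists (exp (f s)); apply is_derive_exp.
Qed.

Lemma twice_on_inv (lo hi : Rbar) (f : R -> R) : (forall s, 0 < f s) ->
  twice_on lo hi f -> twice_on lo hi (fun s => / f s).
Proof.
intros Hpos; apply (twice_on_comp lo hi Rinv (fun v => - / v ^ 2)).
intros s _; assert (H := Hpos s); split; auto_derive; try field; nra.
Qed.

Lemma twice_on_ln (lo hi : Rbar) (f : R -> R) : (forall s, 0 < f s) ->
  twice_on lo hi f -> twice_on lo hi (fun s => ln (f s)).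
Proof.
intros Hpos; apply (twice_on_comp lo hi ln Rinv).
intros s _; assert (H := Hpos s); split; auto_derive; auto; try field; lra.
Qed.

Lemma twice_on_atan (lo hi : Rbar) (f : R -> R) :
  twice_on lo hi f -> twice_on lo hi (fun s => atan (f s)).
Proof.
apply (twice_on_comp lo hi atan (fun v => / (1 + v ^ 2))).
intros s _; split.
- replace (1 + f s ^ 2) with (1 + Rsqr (f s)) by (unfold Rsqr; ring).
  apply is_derive_atan.
- auto_derive; nra.
Qed.

(** * The geodesic equation in coordinates *)

Lemma partial_metric omega i j l p :
  partial i (metric omega j l) p =
  match i, j, l with
  | Ix, It, Iy | Ix, Iy, It => sqrt 2 * omega * expx omega p
  | Ix, Iy, Iy => sqrt 2 * omega * expx omega p ^ 2
  | _, _, _ => 0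
  end.
Proof.
destruct i, j, l; unfold partial, metric, expx; simpl; try apply Derive_const;
  apply is_derive_unique; auto_derive; auto; try ring.
replace (2 * sqrt 2 * omega * pt_x p)
  with (sqrt 2 * omega * pt_x p + sqrt 2 * omega * pt_x p) by ring.
rewrite exp_plus; field.
Qed.

(** Closed form of the Christoffel term, quadratic in the velocity [v]; a geodesic satisfies
    [acc + geodesic_force = 0] in each coordinate. *)
Definition geodesic_force (omega : R) (k : index) (p : point) (v : index -> R) : R :=
  let w := sqrt 2 * omega in
  let E := expx omega p in
  match k with
  | It => w * (2 * v Ix * v It + E * v Ix * v Iy)
  | Ix => w / 2 * (E ^ 2 * v Iy ^ 2 + 2 * E * v It * v Iy)
  | Iy => - 2 * w * v Ix * v It / E
  | Iz => 0
  end.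

Lemma christoffel_force omega k p v :
  sum_index (fun i => sum_index (fun j => christoffel omega k i j p * v i * v j)) =
  geodesic_force omega k p v.
Proof.
assert (HE : expx omega p <> 0) by (apply Rgt_not_eq, expx_pos).
destruct k; unfold sum_index, christoffel, sum_index; rewrite !partial_metric;
  unfold inv_metric, geodesic_force; rewrite ?expx_sqr; field; exact HE.
Qed.

(** * Constants of motion and the geodesic criterion *)

Definition smooth_curve (lo hi : Rbar) (gamma : R -> point) : Prop :=
  forall i, twice_on lo hi (fun s => coord i (gamma s)).

(** Up to constant factors, [const_b], [moment_m] and [moment_g] are the momenta
    of three Killing fields spanning the sl(2) summand of the isometry algebra;
    [moment_m = omega * b * Y]. *)
Definition moment_m (omega : R) (gamma : R -> point) (s : R) : R :=
  omega * const_b omega gamma s * pt_y (gamma s) + sqrt 2 * vel gamma Ix s.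

Definition moment_g (omega : R) (gamma : R -> point) (s : R) : R :=
  const_b omega gamma s * (omega ^ 2 * pt_y (gamma s) ^ 2 - / expx omega (gamma s) ^ 2)
  + 2 * sqrt 2 * omega * vel gamma Ix s * pt_y (gamma s)
  + 4 * const_a omega gamma s / expx omega (gamma s).

Definition moments (omega : R) (gamma : R -> point) (s : R) : R * R * R :=
  (const_b omega gamma s, moment_m omega gamma s, moment_g omega gamma s).

(** Here [f] is the defect of the geodesic equation. The curve need not be a geodesic, so the
    formulas serve both directions of [geodesicE]. *)
Lemma moments_derive omega lo hi gamma s :
  smooth_curve lo hi gamma -> in_itv lo hi s ->
  let p := gamma s in
  let f k := acc gamma k s + geodesic_force omega k p (fun i => vel gamma i s) in
  let E := expx omega p in
  let db := E * (2 * f It + E * f Iy) in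
  is_derive (const_a omega gamma) s (f It + E * f Iy) /\
  is_derive (const_b omega gamma) s db /\
  is_derive (const_c gamma) s (f Iz) /\
  is_derive (moment_m omega gamma) s (omega * pt_y p * db + sqrt 2 * f Ix) /\
  is_derive (moment_g omega gamma) s
    (db * (omega ^ 2 * pt_y p ^ 2 - / E ^ 2) + 2 * sqrt 2 * omega * pt_y p * f Ix
     + 4 * (f It + E * f Iy) / E).
Proof.
intros Hsm Hs p f E db.
set (q := sqrt 2) in *; assert (Hq : q * q = 2) by apply sqrt2_sqr.
(* [field] does not know that [q * q = 2]. Once [omega] is expressed through [k] and [q], and
   [omega ^ 2] through [k], the remaining identities are rational. *)
set (k := q * omega); assert (Hk : omega = k * q / 2).
{ unfold k; replace (q * omega * q / 2) with (q * q * omega / 2) by field.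
  rewrite Hq; field. }
assert (HE := expx_pos omega p); fold E in HE.
pose (x := fun s' => pt_x (gamma s')); pose (y := fun s' => pt_y (gamma s')).
pose (tp := vel gamma It); pose (xp := vel gamma Ix); pose (yp := vel gamma Iy).
assert (Hx : is_derive x s (xp s)) by apply Derive_correct, (Hsm Ix s Hs).
assert (Hy : is_derive y s (yp s)) by apply Derive_correct, (Hsm Iy s Hs).
assert (Htp : is_derive tp s (acc gamma It s)) by apply Derive_correct, (Hsm It s Hs).
assert (Hxp : is_derive xp s (acc gamma Ix s)) by apply Derive_correct, (Hsm Ix s Hs).
assert (Hyp : is_derive yp s (acc gamma Iy s)) by apply Derive_correct, (Hsm Iy s Hs).
pose (a := fun s' => tp s' + exp (k * x s') * yp s').
pose (b := fun s' => exp (k * x s') * (2 * tp s' + exp (k * x s') * yp s')).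
assert (HEx : exp (k * x s) = E) by reflexivity.
assert (HfE : forall i, f i = acc gamma i s +
  match i with
  | It => k * (2 * xp s * tp s + E * xp s * yp s)
  | Ix => k / 2 * (E ^ 2 * yp s ^ 2 + 2 * E * tp s * yp s)
  | Iy => - 2 * k * xp s * tp s / E
  | Iz => 0
  end) by (intros []; reflexivity).
assert (Hex : forall (g : R -> R) l, is_derive g s l -> ex_derive g s)
  by (intros g l Hg; exists l; exact Hg).
assert (Hd : forall (g : R -> R) l, is_derive g s l -> Derive (fun s' => g s') s = l)
  by (intros g l Hg; apply is_derive_unique, Hg).
assert (Da : is_derive a s (f It + E * f Iy)).
{ unfold a; auto_derive; [repeat split; eauto|].
  rewrite (Hd _ _ Hx), (Hd _ _ Htp),
    (Hd _ _ Hyp), !HfE, HEx; field; lra. }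
assert (Db : is_derive b s db).
{ unfold b; auto_derive; [repeat split; eauto|].
  rewrite (Hd _ _ Hx), (Hd _ _ Htp),
    (Hd _ _ Hyp); unfold db; rewrite !HfE, HEx; field; lra. }
change (pt_y p) with (y s).
split; [exact Da | split; [exact Db | split; [|split]]].
- rewrite HfE, Rplus_0_r; apply Derive_correct, (Hsm Iz s Hs).
- apply (is_derive_ext (fun s' => omega * b s' * y s' + q * xp s')); [reflexivity|].
  auto_derive; [repeat split; eauto|].
  rewrite (Hd _ _ Db), (Hd _ _ Hy),
    (Hd _ _ Hxp), !HfE; unfold b; rewrite HEx, Hk; field.
- apply (is_derive_ext (fun s' => b s' * (omega ^ 2 * y s' ^ 2 - / exp (k * x s') ^ 2)
    + 2 * k * xp s' * y s' + 4 * a s' / exp (k * x s'))).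
  { intros s'; unfold moment_g; fold q; replace (2 * q * omega) with (2 * k)
      by (unfold k; ring); reflexivity. }
  replace (2 * q * omega) with (2 * k) by (unfold k; ring).
  replace (omega ^ 2) with (k ^ 2 / 2).
  2:{ unfold k; replace ((q * omega) ^ 2) with (q * q * omega ^ 2) by ring.
      rewrite Hq; field. }
  auto_derive; [repeat split; eauto; rewrite HEx; try apply Rgt_not_eq; nra|].
  rewrite (Hd _ _ Da), (Hd _ _ Db),
    (Hd _ _ Hy), (Hd _ _ Hx),
    (Hd _ _ Hxp), !HfE; unfold a, b; rewrite HEx.
  unfold db; rewrite !HfE; field; lra.
Qed.

Lemma geodesicE omega lo hi gamma :
  geodesic omega lo hi gamma <->
  Rbar_lt lo hi /\ smooth_curve lo hi gamma /\
  forall s1 s2, in_itv lo hi s1 -> in_itv lo hi s2 ->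
    const_a omega gamma s1 = const_a omega gamma s2 /\
    const_c gamma s1 = const_c gamma s2 /\
    moments omega gamma s1 = moments omega gamma s2.
Proof.
split.
- intros [Hlt Hg]; split; [exact Hlt|].
  assert (Hsm : smooth_curve lo hi gamma) by (intros i s Hs; apply (Hg s Hs)).
  split; [exact Hsm|].
  assert (HD : forall s, in_itv lo hi s ->
    is_derive (const_a omega gamma) s 0 /\ is_derive (const_b omega gamma) s 0 /\
    is_derive (const_c gamma) s 0 /\ is_derive (moment_m omega gamma) s 0 /\
    is_derive (moment_g omega gamma) s 0).
  { intros s Hs; destruct (Hg s Hs) as [_ Heq].
    assert (HD := moments_derive omega lo hi gamma s Hsm Hs); simpl in HD.
    assert (HE := expx_pos omega (gamma s)).
    set (E := expx omega (gamma s)) in *.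
    assert (Hf : forall k, acc gamma k s +
        geodesic_force omega k (gamma s) (fun i => vel gamma i s) = 0)
      by (intros k; rewrite <- christoffel_force; apply Heq).
    pose proof (Hf It) as H1; pose proof (Hf Ix) as H2.
    pose proof (Hf Iy) as H3; pose proof (Hf Iz) as H4.
    simpl in H1, H2, H3, H4; fold E in H1, H2, H3; rewrite H1, H2, H3, H4 in HD.
    destruct HD as (D1 & D2 & D3 & D4 & D5).
    repeat match goal with |- _ /\ _ => split end;
      match goal with |- is_derive ?h s 0 =>
        match goal with D : is_derive h s ?l |- _ => replace 0 with l; [exact D|] end end;
      field; lra. }
  intros s1 s2 H1 H2; unfold moments.
  rewrite (null_derivative_itv lo hi (const_a omega gamma)
    (fun s Hs => proj1 (HD s Hs)) s1 s2 H1 H2).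
  rewrite (null_derivative_itv lo hi (const_b omega gamma)
    (fun s Hs => proj1 (proj2 (HD s Hs))) s1 s2 H1 H2).
  rewrite (null_derivative_itv lo hi (const_c gamma)
    (fun s Hs => proj1 (proj2 (proj2 (HD s Hs)))) s1 s2 H1 H2).
  rewrite (null_derivative_itv lo hi (moment_m omega gamma)
    (fun s Hs => proj1 (proj2 (proj2 (proj2 (HD s Hs))))) s1 s2 H1 H2).
  rewrite (null_derivative_itv lo hi (moment_g omega gamma)
    (fun s Hs => proj2 (proj2 (proj2 (proj2 (HD s Hs))))) s1 s2 H1 H2).
  auto.
- intros (Hlt & Hsm & Hc); split; [exact Hlt|].
  intros s Hs; split; [intros i; apply (Hsm i s Hs)|].
  assert (HD := moments_derive omega lo hi gamma s Hsm Hs); cbv zeta in HD.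
  set (f := fun k => acc gamma k s +
    geodesic_force omega k (gamma s) (fun i => vel gamma i s)) in HD.
  intros k; rewrite christoffel_force; change (f k = 0).
  destruct HD as (D1 & D2 & D3 & D4 & _).
  apply is_derive_unique in D1, D2, D3, D4.
  rewrite (is_derive_unique _ _ 0) in D1
    by (apply (const_itv_derivative lo hi); [intros; apply Hc|]; assumption).
  rewrite (is_derive_unique _ _ 0) in D2
    by (apply (const_itv_derivative lo hi); [|assumption];
        intros s1 s2 H1 H2; destruct (Hc s1 s2 H1 H2) as (_ & _ & Hm); injection Hm; auto).
  rewrite (is_derive_unique _ _ 0) in D3
    by (apply (const_itv_derivative lo hi); [intros; apply Hc|]; assumption).
  rewrite (is_derive_unique _ _ 0) in D4
    by (apply (const_itv_derivative lo hi); [|assumption];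
        intros s1 s2 H1 H2; destruct (Hc s1 s2 H1 H2) as (_ & _ & Hm);
        injection Hm; auto).
  (* As [b] is constant, its derivative drops out of that of [moment_m], which leaves only
     [sqrt 2 * f Ix]. *)
  rewrite <- D2, Rmult_0_r, Rplus_0_l in D4.
  assert (HE := expx_pos omega (gamma s)).
  set (E := expx omega (gamma s)) in *.
  assert (H2 := sqrt2_pos).
  (* Constancy of [b] gives this equation and constancy of [a] gives [f It + E * f Iy = 0]; together
     they force [f It = f Iy = 0]. *)
  assert (Ht : 2 * f It + E * f Iy = 0)
    by (apply (Rmult_eq_reg_l E); [rewrite <- D2; ring | lra]).
  assert (Hy : E * f Iy = 0) by lra.
  assert (Hy' : f Iy = 0) by (apply (Rmult_eq_reg_l E); lra).
  destruct k; try lra.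
  apply (Rmult_eq_reg_l (sqrt 2)); lra.
Qed.

(** * The squared length of the velocity *)

Definition metric_norm (omega : R) (gamma : R -> point) (s : R) : R :=
  sum_index (fun i => sum_index (fun j =>
    metric omega i j (gamma s) * vel gamma i s * vel gamma j s)).

(** The determinant of the symmetric matrix with rows [(b, m)] and [(m, g)]; up to a factor, the
    invariant quadratic form of sl(2). *)
Definition discriminant (v : R * R * R) : R :=
  let '(b, m, g) := v in b * g - m ^ 2.

Lemma metric_norm_moments omega gamma s :
  metric_norm omega gamma s =
  discriminant (moments omega gamma s) / 2 - const_a omega gamma s ^ 2
    - const_c gamma s ^ 2.
Proof.
assert (HE := expx_pos omega (gamma s)); assert (Hq := sqrt2_sqr).
unfold metric_norm, sum_index, metric, discriminant, moments, moment_m, moment_g,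
  const_b, const_a, const_c; rewrite expx_sqr.
set (E := expx omega (gamma s)) in *; set (x' := vel gamma Ix s).
set (q := sqrt 2) in *; set (b := E * (2 * _ + _)); set (y := pt_y (gamma s)).
replace ((omega * b * y + q * x') ^ 2)
  with ((omega * b * y) ^ 2 + 2 * q * omega * b * y * x' + q * q * x' ^ 2) by ring.
rewrite Hq; unfold b; field; lra.
Qed.

(** On a lightlike curve the left side is a sum of squares. This is the source of [a * b >= 0], of
    the vanishing of the velocity in the case of equality and, after completing a square, of
    [c ^ 2 <= a ^ 2]. *)
Lemma metric_norm_squares omega gamma s :
  metric_norm omega gamma s + const_a omega gamma s ^ 2 + const_c gamma s ^ 2
    + vel gamma Ix s ^ 2 + (const_b omega gamma s / expx omega (gamma s)) ^ 2 / 2 =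
  2 * (const_a omega gamma s * const_b omega gamma s) / expx omega (gamma s).
Proof.
assert (HE := expx_pos omega (gamma s)).
unfold metric_norm, sum_index, metric, const_b, const_a, const_c; rewrite expx_sqr.
field; lra.
Qed.

(** * The hyperboloid and cylindrical coordinates *)

Definition hyp_eta (omega : R) (p : point) : R := expx omega p * (omega * pt_y p).

Definition hyp_cosh (omega : R) (p : point) : R :=
  radial_cosh (expx omega p) (hyp_eta omega p).

(** [(hyp_cosh, hyp_xi, hyp_eta)] is the point of the hyperboloid
    [cosh^2 - xi^2 - eta^2 = 1] with polar coordinates [(2 r, omega phi)]. *)
Definition hyp_xi (omega : R) (p : point) : R := expx omega p - hyp_cosh omega p.

(** The coordinate [u], solved from the tangent equation. Like the three hyperboloid coordinates,
    and unlike [phi], it is smooth across the axis [r = 0]. *)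
Definition polar_u (omega : R) (p : point) : R :=
  pt_t p + 2 / omega * atan (hyp_eta omega p / (1 + expx omega p)).

(** The moments are [2 a] times the position on the hyperboloid plus [1 / omega]
    times the Minkowski cross product of position and velocity. *)
Lemma moments_hyperboloid omega (gamma : R -> point) s : 0 < omega ->
  (forall i, ex_derive (fun s' => coord i (gamma s')) s) ->
  let C := hyp_cosh omega (gamma s) in
  let A := hyp_xi omega (gamma s) in
  let N := hyp_eta omega (gamma s) in
  let dC := Derive (fun s' => hyp_cosh omega (gamma s')) s in
  let dA := Derive (fun s' => hyp_xi omega (gamma s')) s in
  let dN := Derive (fun s' => hyp_eta omega (gamma s')) s in
  let dU := Derive (fun s' => polar_u omega (gamma s')) s in
  let a := const_a omega gamma s in
  let b := const_b omega gamma s in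
  let g := moment_g omega gamma s in
  ex_derive (fun s' => hyp_xi omega (gamma s')) s /\
  ex_derive (fun s' => hyp_eta omega (gamma s')) s /\
  a = dU + (A * dN - N * dA) / (omega * (C + 1)) /\
  (b + g) / 2 = 2 * a * C - (A * dN - N * dA) / omega /\
  (b - g) / 2 = 2 * a * A - (C * dN - N * dC) / omega /\
  moment_m omega gamma s = 2 * a * N + (C * dA - A * dC) / omega.
Proof.
intros Hw Hg.
pose (t := fun s' => pt_t (gamma s')).
pose (x := fun s' => pt_x (gamma s')); pose (y := fun s' => pt_y (gamma s')).
assert (Ht : is_derive t s (vel gamma It s)) by apply Derive_correct, (Hg It).
assert (Hx : is_derive x s (vel gamma Ix s)) by apply Derive_correct, (Hg Ix).
assert (Hy : is_derive y s (vel gamma Iy s)) by apply Derive_correct, (Hg Iy).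
set (t' := vel gamma It s) in *; set (x' := vel gamma Ix s) in *.
set (y' := vel gamma Iy s) in *.
set (k := sqrt 2 * omega).
assert (Hex : forall (f : R -> R) l, is_derive f s l -> ex_derive f s)
  by (intros f l Hf; exists l; exact Hf).
assert (Hd : forall (f : R -> R) l, is_derive f s l -> Derive (fun s' => f s') s = l)
  by (intros f l Hf; apply is_derive_unique, Hf).
pose (E := fun s' => exp (k * x s')).
pose (E' := k * x' * E s).
assert (HE : 0 < E s) by apply exp_pos.
assert (DE : is_derive E s E').
{ unfold E; auto_derive; [eauto|].
  rewrite (Hd _ _ Hx); unfold E', E; ring. }
pose (N := fun s' => E s' * (omega * y s')).
pose (N' := E' * (omega * y s) + E s * (omega * y')).
assert (DN : is_derive N s N').
{ unfold N; auto_derive; [split; eauto|].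
  rewrite (Hd _ _ DE), (Hd _ _ Hy); unfold N'; ring. }
pose (C := fun s' => radial_cosh (E s') (N s')).
pose (C' := (E' - E' / E s ^ 2 + 2 * N s * N' / E s - N s ^ 2 * E' / E s ^ 2) / 2).
assert (DC : is_derive C s C').
{ unfold C, radial_cosh; auto_derive; [repeat split; eauto; lra|].
  rewrite (Hd _ _ DE), (Hd _ _ DN); unfold C'; field; lra. }
assert (DA : is_derive (fun s' => E s' - C s') s (E' - C'))
  by (apply (is_derive_minus E C); assumption).
assert (Hden : 0 < (1 + E s) ^ 2 + N s ^ 2) by (assert (Hn := pow2_ge_0 (N s)); nra).
pose (U := fun s' => t s' + 2 / omega * atan (N s' / (1 + E s'))).
pose (U' := t' + 2 / omega * ((N' * (1 + E s) - N s * E') / ((1 + E s) ^ 2 + N s ^ 2))).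
assert (DU : is_derive U s U').
{ unfold U; auto_derive; [repeat split; eauto; lra|].
  rewrite (Hd _ _ DE), (Hd _ _ DN), (Hd _ _ Ht); unfold U'; field.
  repeat split; lra. }
intros CC A NN dC dA dN dU a b g.
assert (EC : dC = C') by (apply is_derive_unique, DC).
assert (EA : dA = E' - C') by (apply is_derive_unique, DA).
assert (EN : dN = N') by (apply is_derive_unique, DN).
assert (EU : dU = U') by (apply is_derive_unique, DU).
split; [exists (E' - C'); exact DA|].
split; [exists N'; exact DN|].
rewrite EC, EA, EN, EU.
assert (Ha : a = t' + E s * y') by reflexivity.
assert (Hb : b = E s * (2 * t' + E s * y')) by reflexivity.
(* Written with [k], the moments no longer contain the square root of 2, and the four claims become
   rational identities. *)
assert (Hgg : g = b * (omega ^ 2 * y s ^ 2 - / E s ^ 2) + 2 * k * x' * y s + 4 * a / E s)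
  by (unfold g, moment_g, k; fold x' a b; change (expx omega (gamma s)) with (E s);
      change (pt_y (gamma s)) with (y s); ring).
assert (Hm : moment_m omega gamma s = omega * b * y s + k * x' / omega)
  by (unfold moment_m, k; fold x' b; change (pt_y (gamma s)) with (y s); field; lra).
rewrite Hm, Hgg.
change A with (E s - CC); change NN with (E s * (omega * y s)).
change CC with (radial_cosh (E s) (E s * (omega * y s))).
unfold radial_cosh, U', C', N', E', N; rewrite Hb, Ha.
assert (Hden' : 0 < (1 + E s) ^ 2 + (E s * (omega * y s)) ^ 2) by exact Hden.
clear -Hw HE Hden'.
set (e := E s) in *; set (Y := y s) in *; clearbody e Y k t' x' y'.
(* This is [2 * e * (C + 1)] expanded, the denominator that [field] meets. *)
assert (Hd2 : 0 < e ^ 2 + 1 + (e * (omega * Y)) ^ 2 + 2 * e) by lra.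
split; [|split; [|split]]; field; repeat split; try lra; nra.
Qed.

(** With [C = cosh (2 * r)], the polar equations give [(E - C) ^ 2 + eta ^ 2 = C ^ 2 - 1]. The
    squares of [C] cancel, and [radial_cosh] is the solution of the remaining linear equation. *)
Lemma polar_hyperboloid omega u r phi z p : 0 < omega ->
  polar_coords omega u r phi z p ->
  hyp_cosh omega p = cosh (2 * r) /\
  hyp_xi omega p = sinh (2 * r) * cos (omega * phi) /\
  hyp_eta omega p = sinh (2 * r) * sin (omega * phi) /\
  polar_u omega p = u.
Proof.
intros Hw Hp; apply polar_coordsP in Hp as (_ & H1 & H2 & Ht & _); auto.
assert (HE := expx_pos omega p).
assert (HC : hyp_cosh omega p = cosh (2 * r)).
{ assert (Hcs := cosh2_sinh2 (2 * r)).
  assert (Hsc := sin2_cos2 (omega * phi)); unfold Rsqr in Hsc.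
  assert (Hm : expx omega p ^ 2 + 1 + hyp_eta omega p ^ 2 = 2 * expx omega p * cosh (2 * r)).
  { unfold hyp_eta; rewrite H2, H1.
    set (c := cosh (2 * r)) in *; set (s := sinh (2 * r)) in *.
    set (co := cos (omega * phi)) in *; set (si := sin (omega * phi)) in *.
    replace ((c + s * co) ^ 2 + 1 + (s * si) ^ 2)
      with (c ^ 2 + 2 * c * s * co + s ^ 2 * (si * si + co * co) + 1) by ring.
    rewrite Hsc; replace (s ^ 2) with (c ^ 2 - 1) by lra; ring. }
  unfold hyp_cosh, radial_cosh.
  replace ((expx omega p + / expx omega p + hyp_eta omega p ^ 2 / expx omega p) / 2)
    with ((expx omega p ^ 2 + 1 + hyp_eta omega p ^ 2) / (2 * expx omega p)) by (field; lra).
  rewrite Hm; field; lra. }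
split; [exact HC|]; split; [unfold hyp_xi; rewrite HC; lra|]; split; [exact H2|].
unfold polar_u, hyp_eta; rewrite Ht; ring.
Qed.

(** Identifies the denominator and the numerator of [alpha]. The polar expressions are valid on a
    neighbourhood of [s], so they may be differentiated. *)
Lemma polar_const_a omega gamma u r phi s : 0 < omega ->
  (forall i, ex_derive (fun s' => coord i (gamma s')) s) ->
  polar_lift_at omega gamma u r phi s ->
  const_a omega gamma s = Derive u s + 2 * sinh (r s) ^ 2 * Derive phi s /\
  2 * const_a omega gamma s * cosh (2 * r s) - sinh (2 * r s) ^ 2 * Derive phi s =
  (const_b omega gamma s + moment_g omega gamma s) / 2.
Proof.
intros Hw Hg (Hp & Hu & Hr & Hphi).
destruct (moments_hyperboloid omega gamma s Hw Hg) as (_ & _ & Ha & Hk & _).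
set (th := omega * phi s).
assert (HX : Derive (fun s' => hyp_xi omega (gamma s')) s =
  2 * Derive r s * cosh (2 * r s) * cos th - sinh (2 * r s) * (sin th * (omega * Derive phi s))).
{ rewrite (Derive_ext_loc _ (fun s' => sinh (2 * r s') * cos (omega * phi s'))).
  2:{ apply (filter_imp _ _ (fun s' H => proj1 (proj2
        (polar_hyperboloid _ _ _ _ _ _ Hw H))) Hp). }
  apply is_derive_unique; auto_derive; auto.
  change (Derive (fun s' => r s') s) with (Derive r s).
  change (Derive (fun s' => phi s') s) with (Derive phi s); fold th; ring. }
assert (HN : Derive (fun s' => hyp_eta omega (gamma s')) s =
  2 * Derive r s * cosh (2 * r s) * sin th + sinh (2 * r s) * (cos th * (omega * Derive phi s))).
{ rewrite (Derive_ext_loc _ (fun s' => sinh (2 * r s') * sin (omega * phi s'))).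
  2:{ apply (filter_imp _ _ (fun s' H => proj1 (proj2 (proj2
        (polar_hyperboloid _ _ _ _ _ _ Hw H)))) Hp). }
  apply is_derive_unique; auto_derive; auto.
  change (Derive (fun s' => r s') s) with (Derive r s).
  change (Derive (fun s' => phi s') s) with (Derive phi s); fold th; ring. }
assert (HU : Derive (fun s' => polar_u omega (gamma s')) s = Derive u s).
{ apply Derive_ext_loc, (filter_imp _ _ (fun s' H => proj2 (proj2 (proj2
    (polar_hyperboloid _ _ _ _ _ _ Hw H)))) Hp). }
destruct (polar_hyperboloid _ _ _ _ _ _ Hw (locally_singleton _ _ Hp)) as (HC & HA & Het & _).
rewrite HX, HN, HU, HC, HA, Het in Ha; rewrite HX, HN, HC, HA, Het in Hk.
fold th in Ha, Hk.
assert (Hsc := sin2_cos2 th); unfold Rsqr in Hsc.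
assert (Hcs := cosh2_sinh2 (2 * r s)).
(* Angular momentum in the plane of [xi] and [eta]: squared radius times angular velocity; the terms
   in [Derive r s] cancel. *)
assert (Hcross : sinh (2 * r s) * cos th *
  (2 * Derive r s * cosh (2 * r s) * sin th + sinh (2 * r s) * (cos th * (omega * Derive phi s)))
  - sinh (2 * r s) * sin th *
  (2 * Derive r s * cosh (2 * r s) * cos th - sinh (2 * r s) * (sin th * (omega * Derive phi s)))
  = omega * (sinh (2 * r s) ^ 2 * Derive phi s)).
{ transitivity ((sin th * sin th + cos th * cos th) *
    (omega * (sinh (2 * r s) ^ 2 * Derive phi s))); [ring|rewrite Hsc; ring]. }
rewrite Hcross in Ha, Hk.
assert (Hhalf : 2 * sinh (r s) ^ 2 = cosh (2 * r s) - 1).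
{ unfold sinh, cosh; replace (2 * r s) with (r s + r s) by ring.
  rewrite Ropp_plus_distr, !exp_plus.
  assert (H : exp (r s) * exp (- r s) = 1) by (rewrite <- exp_plus, Rplus_opp_r; apply exp_0).
  nra. }
assert (Hpos : 0 < cosh (2 * r s) + 1) by (assert (H := pow2_ge_0 (sinh (r s))); lra).
split.
- rewrite Ha, Hhalf; replace (sinh (2 * r s) ^ 2)
    with ((cosh (2 * r s) - 1) * (cosh (2 * r s) + 1)) by lra.
  field; lra.
- rewrite Hk; field; lra.
Qed.

Lemma alpha_moments omega lo hi gamma u r phi s : 0 < omega ->
  smooth_curve lo hi gamma -> in_itv lo hi s -> polar_lift_at omega gamma u r phi s ->
  alpha omega gamma u r phi s =
  (const_b omega gamma s + moment_g omega gamma s) / 2 / const_a omega gamma s.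
Proof.
intros Hw Hsm Hs Hl.
destruct (polar_const_a omega gamma u r phi s) as [H1 H2]; auto.
{ intros i; apply (Hsm i s Hs). }
unfold alpha; rewrite H2, <- H1; reflexivity.
Qed.

(** * Action of the isometries on the moments *)

Definition scale (k : R) (v : R * R * R) : R * R * R :=
  let '(b, m, g) := v in (k * b, k * m, k * g).

(** [F] is tested on curves, so no differential of [F] is needed. Homogeneity allows division by [a]
    of either sign, invariance of the discriminant preserves the lightlike condition, and the third
    clause keeps [L] inside the half [b > 0] of the cone [b * g > m ^ 2]. *)
Definition moment_action (omega : R) (F : point -> point)
    (L : R * R * R -> R * R * R) : Prop :=
  (forall k v, L (scale k v) = scale k (L v)) /\
  (forall v, discriminant (L v) = discriminant v) /\
  (forall v, 0 < fst (fst v) -> 0 < discriminant v -> 0 < fst (fst (L v))) /\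
  (forall lo hi gamma, smooth_curve lo hi gamma ->
    smooth_curve lo hi (fun s => F (gamma s)) /\
    forall s, in_itv lo hi s ->
      const_a omega (fun s' => F (gamma s')) s = const_a omega gamma s /\
      const_c (fun s' => F (gamma s')) s = const_c gamma s /\
      moments omega (fun s' => F (gamma s')) s = L (moments omega gamma s)).

Lemma moment_action_id omega : moment_action omega (fun p => p) (fun v => v).
Proof. unfold moment_action; auto 10. Qed.

Lemma moment_action_comp omega F G LF LG :
  moment_action omega F LF -> moment_action omega G LG ->
  moment_action omega (fun p => F (G p)) (fun v => LF (LG v)).
Proof.
intros (F1 & F2 & F3 & F4) (G1 & G2 & G3 & G4); split; [|split; [|split]].
- intros k v; rewrite G1, F1; reflexivity.
- intros v; rewrite F2, G2; reflexivity.
- intros v Hb Hd; apply F3; [apply G3; auto | rewrite G2; exact Hd].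
- intros lo hi gamma Hg.
  destruct (G4 lo hi gamma Hg) as [HG1 HG2].
  destruct (F4 lo hi _ HG1) as [HF1 HF2]; split; [exact HF1|].
  intros s Hs; destruct (HG2 s Hs) as (A1 & A2 & A3), (HF2 s Hs) as (B1 & B2 & B3).
  rewrite B1, B2, B3, A1, A2, A3; auto.
Qed.

(** Congruence of the symmetric matrix with rows [(b, m)], [(m, g)] by the unipotent matrix with
    rows [(1, 0)], [(omega * y0, 1)]. *)
Definition translation_moments (omega y0 : R) (v : R * R * R) : R * R * R :=
  let '(b, m, g) := v in
  (b, m + omega * y0 * b, g + 2 * omega * y0 * m + (omega * y0) ^ 2 * b).

Lemma translation_moment_action omega t0 y0 z0 :
  moment_action omega (translation t0 y0 z0) (translation_moments omega y0).
Proof.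
split; [|split; [|split]].
- intros k [[b m] g]; simpl; apply f_equal2; [apply f_equal2|]; ring.
- intros [[b m] g]; simpl; ring.
- intros [[b m] g]; auto.
- intros lo hi gamma Hg; split.
  + intros [].
    * apply twice_on_plus; [apply (Hg It) | apply twice_on_const].
    * apply (Hg Ix).
    * apply twice_on_plus; [apply (Hg Iy) | apply twice_on_const].
    * apply twice_on_plus; [apply (Hg Iz) | apply twice_on_const].
  + intros s Hs.
    assert (Hv : forall i, vel (fun s' => translation t0 y0 z0 (gamma s')) i s = vel gamma i s).
    { assert (Hplus : forall (f : R -> R) c, ex_derive f s ->
        Derive (fun s' => f s' + c) s = Derive f s)
        by (intros f c Hf; apply is_derive_unique; auto_derive; [auto | apply Rmult_1_l]).
      unfold vel; intros []; simpl.
      - apply Hplus, (Hg It s Hs).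
      - reflexivity.
      - apply Hplus, (Hg Iy s Hs).
      - apply Hplus, (Hg Iz s Hs). }
    unfold moments, moment_m, moment_g, const_b, const_a, const_c, translation_moments,
      moments, moment_m, moment_g, const_b, const_a.
    rewrite !Hv; change (expx omega (translation t0 y0 z0 (gamma s)))
      with (expx omega (gamma s)).
    change (pt_y (translation t0 y0 z0 (gamma s))) with (pt_y (gamma s) + y0).
    split; [reflexivity|]; split; [reflexivity|].
    cbv beta iota; apply f_equal2; [apply f_equal2|]; ring.
Qed.

(** For [k > 0], congruence of the same matrix by the diagonal matrix with entries [sqrt k] and
    [/ sqrt k]. *)
Definition dilatation_moments (k : R) (v : R * R * R) : R * R * R :=
  let '(b, m, g) := v in (k * b, m, g / k).

Lemma dilatation_moment_action omega x0 :
  moment_action omega (dilatation omega x0)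
    (dilatation_moments (exp (sqrt 2 * omega * x0))).
Proof.
assert (Hk := exp_pos (sqrt 2 * omega * x0)).
split; [|split; [|split]].
- intros k [[b m] g]; simpl; apply f_equal2; [apply f_equal2|]; field; lra.
- intros [[b m] g]; simpl; field; lra.
- intros [[b m] g]; simpl; intros; apply Rmult_lt_0_compat; auto.
- intros lo hi gamma Hg; split.
  + intros [].
    * apply (Hg It).
    * apply twice_on_plus; [apply (Hg Ix) | apply twice_on_const].
    * apply twice_on_mult; [apply (Hg Iy) | apply twice_on_const].
    * apply (Hg Iz).
  + intros s Hs.
    set (D := fun s' => dilatation omega x0 (gamma s')).
    set (k := exp (sqrt 2 * omega * x0)) in *.
    pose (x := fun s' => pt_x (gamma s')); pose (y := fun s' => pt_y (gamma s')).
    assert (Hx : vel D Ix s = vel gamma Ix s).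
    { apply is_derive_unique; change (is_derive (fun s' => x s' + x0) s (vel gamma Ix s)).
      auto_derive; [apply (Hg Ix s Hs) | apply Rmult_1_l]. }
    assert (Hy : vel D Iy s = vel gamma Iy s / k).
    { apply is_derive_unique; change (is_derive (fun s' =>
        y s' * exp (- (sqrt 2 * omega * x0))) s (vel gamma Iy s / k)).
      auto_derive; [apply (Hg Iy s Hs)|].
      rewrite exp_Ropp; fold k; apply (f_equal2 Rmult); [apply Rmult_1_l | reflexivity]. }
    assert (HE : expx omega (D s) = k * expx omega (gamma s)).
    { unfold expx, k, D; simpl; rewrite <- exp_plus; f_equal; ring. }
    assert (HYs : pt_y (D s) = pt_y (gamma s) / k)
      by (unfold D; simpl; rewrite exp_Ropp; reflexivity).
    unfold moments, moment_m, moment_g, const_b, const_a, const_c, dilatation_moments,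
      moments, moment_m, moment_g, const_b, const_a.
    change (vel D It s) with (vel gamma It s); change (vel D Iz s) with (vel gamma Iz s).
    assert (HEp := expx_pos omega (gamma s)).
    rewrite Hx, Hy, HE, HYs.
    split; [field; lra|]; split; [reflexivity|].
    apply f_equal2; [apply f_equal2|]; field; lra.
Qed.

(** In any cylindrical coordinates of [p] the rotation keeps [r] and [u] and shifts [phi], so the
    addition formulas give a linear action. The positive quantity is [expx] of the image, the
    argument of [ln] in [rotation]. *)
Lemma rotation_hyperboloid omega phi0 p : 0 < omega ->
  let q := rotation omega phi0 p in
  let c := cos (omega * phi0) in
  let si := sin (omega * phi0) in
  0 < hyp_cosh omega p + (hyp_xi omega p * c - hyp_eta omega p * si) /\
  hyp_cosh omega q = hyp_cosh omega p /\
  hyp_xi omega q = hyp_xi omega p * c - hyp_eta omega p * si /\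
  hyp_eta omega q = hyp_xi omega p * si + hyp_eta omega p * c /\
  polar_u omega q = polar_u omega p.
Proof.
intros Hw q c si.
destruct (polar_coords_exist omega p Hw) as (u & r & phi & Hp).
assert (Hq := rotation_is_rotation omega phi0 Hw _ _ _ _ _ Hp); fold q in Hq.
destruct (polar_hyperboloid _ _ _ _ _ _ Hw Hp) as (C1 & A1 & N1 & U1).
destruct (polar_hyperboloid _ _ _ _ _ _ Hw Hq) as (C2 & A2 & N2 & U2).
assert (HA : hyp_xi omega q = hyp_xi omega p * c - hyp_eta omega p * si).
{ rewrite A2, A1, N1, Rmult_plus_distr_l, cos_plus; unfold c, si; ring. }
split; [|split; [congruence|split; [exact HA|split; [|congruence]]]].
- rewrite <- HA; assert (HE := expx_pos omega q).
  replace (hyp_cosh omega p) with (hyp_cosh omega q) by congruence.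
  unfold hyp_xi; lra.
- rewrite N2, A1, N1, Rmult_plus_distr_l, sin_plus; unfold c, si; ring.
Qed.

Lemma rotation_smooth omega phi0 lo hi gamma : 0 < omega ->
  smooth_curve lo hi gamma -> smooth_curve lo hi (fun s => rotation omega phi0 (gamma s)).
Proof.
intros Hw Hg.
assert (Hpos : forall s, 0 < hyp_cosh omega (gamma s) +
    (expx omega (gamma s) - hyp_cosh omega (gamma s)) * cos (omega * phi0)
    - hyp_eta omega (gamma s) * sin (omega * phi0)).
{ intros s; destruct (rotation_hyperboloid omega phi0 (gamma s) Hw) as [H _].
  unfold hyp_xi in H; lra. }
assert (HE : twice_on lo hi (fun s => expx omega (gamma s))).
{ apply twice_on_exp, twice_on_mult; [apply twice_on_const | apply (Hg Ix)]. }
assert (HEp : forall s, 0 < expx omega (gamma s)) by (intros s; apply expx_pos).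
assert (HN : twice_on lo hi (fun s => hyp_eta omega (gamma s))).
{ apply twice_on_mult; [exact HE|].
  apply twice_on_mult; [apply twice_on_const | apply (Hg Iy)]. }
assert (HEi := twice_on_inv _ _ _ HEp HE).
assert (HC : twice_on lo hi (fun s => hyp_cosh omega (gamma s))).
{ apply twice_on_mult; [|apply twice_on_const].
  apply twice_on_plus; [apply twice_on_plus; [exact HE | exact HEi]|].
  apply twice_on_mult; [|exact HEi].
  apply twice_on_mult; [exact HN|].
  apply twice_on_mult; [exact HN | apply twice_on_const]. }
assert (HE' : twice_on lo hi (fun s => hyp_cosh omega (gamma s) +
    (expx omega (gamma s) - hyp_cosh omega (gamma s)) * cos (omega * phi0)
    - hyp_eta omega (gamma s) * sin (omega * phi0))).
{ apply twice_on_minus; [apply twice_on_plus; [exact HC|]|].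
  - apply twice_on_mult; [apply twice_on_minus; assumption | apply twice_on_const].
  - apply twice_on_mult; [exact HN | apply twice_on_const]. }
assert (HN' : twice_on lo hi (fun s =>
    (expx omega (gamma s) - hyp_cosh omega (gamma s)) * sin (omega * phi0)
    + hyp_eta omega (gamma s) * cos (omega * phi0))).
{ apply twice_on_plus.
  - apply twice_on_mult; [apply twice_on_minus; assumption | apply twice_on_const].
  - apply twice_on_mult; [exact HN | apply twice_on_const]. }
assert (Hatan : forall f g, (forall s, 0 < g s) -> twice_on lo hi f -> twice_on lo hi g ->
    twice_on lo hi (fun s => 2 / omega * atan (f s / (1 + g s)))).
{ intros f g Hp Hf Hgg; apply twice_on_mult; [apply twice_on_const|].
  apply twice_on_atan, twice_on_mult; [exact Hf|].
  apply twice_on_inv; [intros s; assert (H := Hp s); lra|].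
  apply twice_on_plus; [apply twice_on_const | exact Hgg]. }
intros [].
- apply twice_on_minus; [apply twice_on_plus; [apply (Hg It)|]|]; apply Hatan; assumption.
- apply twice_on_mult; [|apply twice_on_const].
  apply twice_on_ln; assumption.
- apply twice_on_mult; [exact HN'|].
  apply twice_on_inv; [intros s; apply Rmult_lt_0_compat; [exact Hw | apply Hpos]|].
  apply twice_on_mult; [apply twice_on_const | exact HE'].
- apply (Hg Iz).
Qed.

(** The half-sum and half-difference [(b + g) / 2], [(b - g) / 2] turn the
    discriminant into the Minkowski form [k^2 - d^2 - m^2]. *)
Definition rotation_moments (th : R) (v : R * R * R) : R * R * R :=
  let '(b, m, g) := v in
  let d := (b - g) / 2 * cos th - m * sin th in
  ((b + g) / 2 + d, (b - g) / 2 * sin th + m * cos th, (b + g) / 2 - d).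

(** Position and velocity on the hyperboloid rotate by the same linear map, and the Minkowski cross
    product commutes with it; its component along the axis is fixed. Hence [b + g] and [a] are
    invariant, while [(b - g) / 2] and [m] rotate. *)
Lemma rotation_moment_action omega phi0 : 0 < omega ->
  moment_action omega (rotation omega phi0) (rotation_moments (omega * phi0)).
Proof.
intros Hw; set (th := omega * phi0).
assert (Hsc := sin2_cos2 th); unfold Rsqr in Hsc.
assert (Hrot : forall d m, (d * cos th - m * sin th) ^ 2 + (d * sin th + m * cos th) ^ 2 =
  d ^ 2 + m ^ 2).
{ intros d m; transitivity ((sin th * sin th + cos th * cos th) * (d ^ 2 + m ^ 2));
    [ring|rewrite Hsc; ring]. }
split; [|split; [|split]].
- intros k [[b m] g]; simpl; apply f_equal2; [apply f_equal2|]; field.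
- intros [[b m] g]; unfold rotation_moments, discriminant.
  assert (H := Hrot ((b - g) / 2) m).
  replace (b * g - m ^ 2) with (((b + g) / 2) ^ 2 - (((b - g) / 2) ^ 2 + m ^ 2)) by field.
  rewrite <- H; ring.
- intros [[b m] g]; simpl; intros Hb Hd.
  assert (H := Hrot ((b - g) / 2) m).
  set (d := (b - g) / 2 * cos th - m * sin th) in *.
  assert (Hm2 := pow2_ge_0 ((b - g) / 2 * sin th + m * cos th)).
  assert (Hm := pow2_ge_0 m).
  assert (Hg : 0 < g) by nra.
  (* A positive discriminant makes the vector timelike, so its time component [(b + g) / 2],
     positive because [b] and [g] are, exceeds [Rabs d]. *)
  assert (Hlt : Rabs d < Rabs ((b + g) / 2)) by (apply Rsqr_lt_abs_0; unfold Rsqr; nra).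
  rewrite (Rabs_pos_eq ((b + g) / 2)) in Hlt by lra.
  apply Rabs_def2 in Hlt; lra.
- intros lo hi gamma Hg.
  assert (Hg' := rotation_smooth omega phi0 lo hi gamma Hw Hg).
  split; [exact Hg'|]; intros s Hs.
  destruct (moments_hyperboloid omega gamma s Hw (fun i => proj1 (Hg i s Hs)))
    as (DA & DN & A1 & K1 & D1 & M1).
  set (delta := fun s' => rotation omega phi0 (gamma s')) in *.
  destruct (moments_hyperboloid omega delta s Hw (fun i => proj1 (Hg' i s Hs)))
    as (_ & _ & A2 & K2 & D2 & M2).
  assert (HR := fun s' => rotation_hyperboloid omega phi0 (gamma s') Hw).
  destruct (HR s) as (_ & HC & HA & HN & _).
  assert (EU : Derive (fun s' => polar_u omega (delta s')) s =
    Derive (fun s' => polar_u omega (gamma s')) s) by (apply Derive_ext; intros; apply HR).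
  assert (EC : Derive (fun s' => hyp_cosh omega (delta s')) s =
    Derive (fun s' => hyp_cosh omega (gamma s')) s) by (apply Derive_ext; intros; apply HR).
  pose (XA := fun s' => hyp_xi omega (gamma s')).
  pose (NA := fun s' => hyp_eta omega (gamma s')).
  assert (EA : Derive (fun s' => hyp_xi omega (delta s')) s =
    Derive (fun s' => hyp_xi omega (gamma s')) s * cos th
    - Derive (fun s' => hyp_eta omega (gamma s')) s * sin th).
  { transitivity (Derive (fun s' => XA s' * cos th - NA s' * sin th) s);
      [apply Derive_ext; intros; apply HR|].
    apply is_derive_unique; auto_derive; [auto|]; unfold XA, NA; cbv beta; ring. }
  assert (EN : Derive (fun s' => hyp_eta omega (delta s')) s =
    Derive (fun s' => hyp_xi omega (gamma s')) s * sin th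
    + Derive (fun s' => hyp_eta omega (gamma s')) s * cos th).
  { transitivity (Derive (fun s' => XA s' * sin th + NA s' * cos th) s);
      [apply Derive_ext; intros; apply HR|].
    apply is_derive_unique; auto_derive; [auto|]; unfold XA, NA; cbv beta; ring. }
  change (rotation omega phi0 (gamma s)) with (delta s) in HC, HA, HN.
  fold th in HA, HN.
  rewrite HC, HA, HN, EA, EN in A2, K2; rewrite EU in A2.
  rewrite HC, HA, HN, EN, EC in D2; rewrite HC, HA, HN, EA, EC in M2.
  set (C := hyp_cosh omega (gamma s)) in *; set (A := hyp_xi omega (gamma s)) in *.
  set (N := hyp_eta omega (gamma s)) in *.
  set (dC := Derive (fun s' => hyp_cosh omega (gamma s')) s) in *.
  set (dA := Derive (fun s' => hyp_xi omega (gamma s')) s) in *.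
  set (dN := Derive (fun s' => hyp_eta omega (gamma s')) s) in *.
  assert (Hcross : (A * cos th - N * sin th) * (dA * sin th + dN * cos th)
    - (A * sin th + N * cos th) * (dA * cos th - dN * sin th) = A * dN - N * dA).
  { transitivity ((sin th * sin th + cos th * cos th) * (A * dN - N * dA));
      [ring|rewrite Hsc; ring]. }
  rewrite Hcross in A2, K2.
  assert (Ha : const_a omega delta s = const_a omega gamma s) by congruence.
  rewrite Ha in K2, D2, M2.
  split; [exact Ha|]; split; [reflexivity|].
  unfold moments, rotation_moments; rewrite K1, D1, M1, M2.
  (* The moments of the image are known through half-sum and half-difference, so [b] and [g] are
     split accordingly. *)
  replace (const_b omega delta s) with ((const_b omega delta s + moment_g omega delta s) / 2
    + (const_b omega delta s - moment_g omega delta s) / 2) by field.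
  replace (moment_g omega delta s) with ((const_b omega delta s + moment_g omega delta s) / 2
    - (const_b omega delta s - moment_g omega delta s) / 2) at 3 by field.
  rewrite K2, D2.
  apply f_equal2; [apply f_equal2|]; field; lra.
Qed.

Lemma is_rotationE omega phi0 F : 0 < omega ->
  is_rotation omega phi0 F -> F = rotation omega phi0.
Proof.
intros Hw HF; destruct (is_rotation_exists_unique omega phi0 Hw) as (R0 & _ & HU).
rewrite <- (HU F HF); apply HU, rotation_is_rotation, Hw.
Qed.

Lemma rotation_opp omega phi0 p : 0 < omega ->
  rotation omega (- phi0) (rotation omega phi0 p) = p.
Proof.
intros Hw; destruct (polar_coords_exist omega p Hw) as (u & r & phi & Hp).
apply (polar_coords_inj omega u r phi (pt_z p)); auto.
replace phi with (phi + phi0 + - phi0) by ring.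
apply rotation_is_rotation, rotation_is_rotation; auto.
Qed.

(** The inverse and its action belong to the statement so that the induction passes through
    [iso_inv], where the two maps exchange roles. The inverse also serves to keep images of
    nonconstant curves nonconstant. *)
Lemma isometry_moment_action omega F : 0 < omega -> isometry_group omega F ->
  exists G LF LG, moment_action omega F LF /\ moment_action omega G LG /\
    (forall p, F (G p) = p) /\ (forall p, G (F p) = p).
Proof.
intros Hw; induction 1 as [t0 y0 z0 | x0 | phi0 F HF | |
  F G HF (F' & LF & LF' & F1 & F2 & F3 & F4) HG (G' & LG & LG' & G1 & G2 & G3 & G4) |
  F G HF (F' & LF & LF' & F1 & F2 & F3 & F4) HFG HGF].
- exists (translation (- t0) (- y0) (- z0)).
  exists (translation_moments omega y0), (translation_moments omega (- y0)).
  split; [apply translation_moment_action|]; split; [apply translation_moment_action|].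
  split; intros [t x y z]; unfold translation; simpl; f_equal; ring.
- exists (dilatation omega (- x0)).
  exists (dilatation_moments (exp (sqrt 2 * omega * x0))).
  exists (dilatation_moments (exp (sqrt 2 * omega * - x0))).
  split; [apply dilatation_moment_action|]; split; [apply dilatation_moment_action|].
  split; intros [t x y z]; unfold dilatation; simpl; f_equal; try ring;
    rewrite Rmult_assoc, <- exp_plus;
    match goal with |- _ * exp ?e = _ => replace e with 0 by ring end;
    rewrite exp_0; ring.
- rewrite (is_rotationE omega phi0 F Hw HF).
  exists (rotation omega (- phi0)).
  exists (rotation_moments (omega * phi0)), (rotation_moments (omega * - phi0)).
  split; [apply rotation_moment_action, Hw|]; split; [apply rotation_moment_action, Hw|].
  split; intros p; [|apply rotation_opp, Hw].
  rewrite <- (Ropp_involutive phi0) at 1; apply rotation_opp, Hw.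
- exists (fun p => p), (fun v => v), (fun v => v).
  split; [apply moment_action_id|]; split; [apply moment_action_id|]; auto.
- exists (fun p => G' (F' p)), (fun v => LF (LG v)), (fun v => LG' (LF' v)).
  split; [apply moment_action_comp; assumption|].
  split; [apply moment_action_comp; assumption|].
  split; intros p; [rewrite G3; apply F3 | rewrite F4; apply G4].
(* A two-sided inverse is unique, so [G] is the inverse supplied by the induction hypothesis. *)
- assert (HG : G = F').
  { apply functional_extensionality; intros p.
    rewrite <- (F3 p) at 1; apply HGF. }
  exists F, LF', LF; rewrite HG; auto.
Qed.

(** * Impact parameters and normalised moments *)

Definition impact (omega : R) (gamma : R -> point) (s : R) : R * R * R :=
  (const_c gamma s / const_a omega gamma s,
   const_b omega gamma s / const_a omega gamma s,
   const_Y omega gamma s).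

(** Expects moments normalised by [a = 1], where [b] is [rho]. For a light ray they determine [l]
    only up to sign, so [l] is a separate argument. *)
Definition ray_of_moments (omega l : R) (v : R * R * R) : R * R * R :=
  let '(b, m, g) := v in (l, b, m / (omega * b)).

(** Normalized by [a = 1]; the last entry solves [b * g - m^2 = 2 * (a^2 + c^2)]. *)
Definition moments_of_ray (omega : R) (beta : R * R * R) : R * R * R :=
  let '(l, rho, Y) := beta in
  (rho, omega * rho * Y, ((omega * rho * Y) ^ 2 + 2 * (1 + l ^ 2)) / rho).

Lemma discriminant_moments_of_ray omega l rho Y : 0 < rho ->
  discriminant (moments_of_ray omega (l, rho, Y)) = 2 * (1 + l ^ 2).
Proof. intros H; simpl; field; lra. Qed.

(** [ray_of_moments] forgets [g], but the discriminant equation recovers it since [b > 0]. *)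
Lemma ray_of_momentsK omega l v : 0 < omega -> 0 < fst (fst v) ->
  discriminant v = 2 * (1 + l ^ 2) ->
  moments_of_ray omega (ray_of_moments omega l v) = v.
Proof.
intros Hw; destruct v as [[b m] g]; unfold moments_of_ray, ray_of_moments, discriminant.
cbn [fst snd]; intros Hb Hd.
assert (Hm : omega * b * (m / (omega * b)) = m) by (field; lra).
rewrite Hm, <- Hd; apply f_equal2; [reflexivity|]; field; lra.
Qed.

Lemma moments_of_rayK omega l rho Y : 0 < omega -> 0 < rho ->
  ray_of_moments omega l (moments_of_ray omega (l, rho, Y)) = (l, rho, Y).
Proof.
intros Hw Hr; unfold ray_of_moments, moments_of_ray; apply f_equal2; [reflexivity|].
field; lra.
Qed.

Lemma impact_moments omega gamma s : 0 < omega ->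
  const_a omega gamma s <> 0 -> const_b omega gamma s <> 0 ->
  impact omega gamma s =
  ray_of_moments omega (const_c gamma s / const_a omega gamma s)
    (scale (/ const_a omega gamma s) (moments omega gamma s)).
Proof.
intros Hw Ha Hb; unfold impact, ray_of_moments, scale, moments, const_Y, moment_m.
apply f_equal2; [apply f_equal2|]; try field; auto; repeat split; auto; lra.
Qed.

(** Vanishing norm reads [b * g - m ^ 2 = 2 * (a ^ 2 + c ^ 2)], which determines [g] because [b] is
    nonzero. *)
Lemma moments_of_impact omega gamma s : 0 < omega ->
  metric_norm omega gamma s = 0 ->
  0 < const_a omega gamma s * const_b omega gamma s ->
  moments omega gamma s =
  scale (const_a omega gamma s) (moments_of_ray omega (impact omega gamma s)).
Proof.
intros Hw Hn Hab; rewrite metric_norm_moments in Hn.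
assert (Ha : const_a omega gamma s <> 0) by (intros H; rewrite H in Hab; lra).
assert (Hb : const_b omega gamma s <> 0) by (intros H; rewrite H in Hab; lra).
assert (Hm : omega * (const_b omega gamma s / const_a omega gamma s) * const_Y omega gamma s
  = moment_m omega gamma s / const_a omega gamma s)
  by (unfold const_Y, moment_m; field; repeat split; auto; lra).
unfold impact, moments_of_ray, scale; rewrite Hm; unfold moments in *; simpl in Hn.
apply f_equal2; [apply f_equal2|]; try (field; auto).
apply (Rmult_eq_reg_l (const_b omega gamma s)); [|exact Hb].
transitivity (moment_m omega gamma s ^ 2
  + 2 * (const_a omega gamma s ^ 2 + const_c gamma s ^ 2)); [simpl; lra|].
field; auto.
Qed.

(** By homogeneity the moments of the image are [a] times [L] of the normalised ones, and [a]
    cancels in the impact parameter. Only the data at [s] enter, so [gamma] may be any smooth curve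
    that is null at [s]. *)
Lemma impact_image omega F L lo hi gamma s : 0 < omega ->
  moment_action omega F L -> smooth_curve lo hi gamma -> in_itv lo hi s ->
  metric_norm omega gamma s = 0 ->
  0 < const_a omega gamma s * const_b omega gamma s ->
  impact omega (fun s' => F (gamma s')) s =
  ray_of_moments omega (const_c gamma s / const_a omega gamma s)
    (L (moments_of_ray omega (impact omega gamma s))).
Proof.
intros Hw (L1 & L2 & L3 & HF) Hg Hs Hn Hab.
destruct (HF lo hi gamma Hg) as [_ HF']; destruct (HF' s Hs) as (Ha & Hc & Hm); clear HF HF'.
rewrite (moments_of_impact omega gamma s Hw Hn Hab), L1 in Hm.
set (a := const_a omega gamma s) in *; set (b := const_b omega gamma s) in *.
assert (Ha0 : a <> 0) by (intros H; rewrite H in Hab; lra).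
assert (Hrho : 0 < b / a).
{ replace (b / a) with (a * b * / a ^ 2) by (field; auto).
  apply Rmult_lt_0_compat; [exact Hab|].
  apply Rinv_0_lt_compat; assert (H := pow2_gt_0 a Ha0); exact H. }
set (l := const_c gamma s / a).
assert (Hpos : 0 < fst (fst (L (moments_of_ray omega (impact omega gamma s))))).
{ apply L3; [exact Hrho|]; unfold impact; fold a b; rewrite discriminant_moments_of_ray by auto.
  assert (H := pow2_ge_0 (const_c gamma s / a)); lra. }
set (w := L _) in *.
assert (Hb : const_b omega (fun s' => F (gamma s')) s <> 0).
{ destruct w as [[b' m'] g']; injection Hm; intros _ _ ->; simpl in Hpos.
  apply Rmult_integral_contrapositive_currified; lra. }
rewrite impact_moments, Ha, Hc, Hm; [|exact Hw|rewrite Ha; exact Ha0|exact Hb].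
f_equal; destruct w as [[b' m'] g']; unfold scale.
apply f_equal2; [apply f_equal2|]; field; auto.
Qed.

(** * The action on the boundary *)

(** In general not a geodesic: only position and velocity at [s = 0] matter. The velocity
    [(1, v, 0, l)] is null with [a = 1], the value of [x] makes [expx] equal to [rho / 2], so that
    [b = rho], and [y] is shifted to produce [Y]. *)
Definition ray_line (omega : R) (beta : R * R * R) (s : R) : point :=
  let '(l, rho, Y) := beta in
  let v := sqrt (1 - l ^ 2) in
  Pt s (ln (rho / 2) / (sqrt 2 * omega) + v * s) (Y - sqrt 2 * v / (omega * rho)) (l * s).

Lemma ray_line_smooth omega beta : smooth_curve m_infty p_infty (ray_line omega beta).
Proof.
destruct beta as [[l rho] Y].
assert (Hid : twice_on m_infty p_infty (fun s => s)).
{ apply (twice_on_derive _ _ _ (fun _ => 1)); intros s _; split.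
  - apply (is_derive_id s).
  - apply ex_derive_const. }
intros [].
- exact Hid.
- apply twice_on_plus; [apply twice_on_const|].
  apply twice_on_mult; [apply twice_on_const | exact Hid].
- apply (twice_on_const _ _ (Y - sqrt 2 * sqrt (1 - l ^ 2) / (omega * rho))).
- apply twice_on_mult; [apply twice_on_const | exact Hid].
Qed.

Lemma ray_line_impact omega beta : 0 < omega -> boundary beta ->
  let gamma := ray_line omega beta in
  metric_norm omega gamma 0 = 0 /\
  0 < const_a omega gamma 0 * const_b omega gamma 0 /\
  impact omega gamma 0 = beta.
Proof.
intros Hw; destruct beta as [[l rho] Y]; intros [Hl Hr] gamma.
assert (Hq := sqrt2_pos).
set (v := sqrt (1 - l ^ 2)).
assert (Hv : v * v = 1 - l ^ 2) by (apply sqrt_sqrt; nra).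
assert (Vt : vel gamma It 0 = 1) by apply Derive_id.
assert (Vx : vel gamma Ix 0 = v).
{ apply is_derive_unique.
  change (is_derive (fun s => ln (rho / 2) / (sqrt 2 * omega) + v * s) 0 v).
  auto_derive; [auto | ring]. }
assert (Vy : vel gamma Iy 0 = 0)
  by apply (Derive_const (Y - sqrt 2 * v / (omega * rho)) 0).
assert (Vz : vel gamma Iz 0 = l).
{ apply is_derive_unique; change (is_derive (fun s => l * s) 0 l).
  auto_derive; [auto | ring]. }
assert (HE : expx omega (gamma 0) = rho / 2).
{ unfold expx; change (pt_x (gamma 0)) with (ln (rho / 2) / (sqrt 2 * omega) + v * 0).
  replace (sqrt 2 * omega * (ln (rho / 2) / (sqrt 2 * omega) + v * 0)) with (ln (rho / 2))
    by (field; lra).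
  apply exp_ln; lra. }
assert (Ha : const_a omega gamma 0 = 1) by (unfold const_a; rewrite Vt, Vy; ring).
assert (Hb : const_b omega gamma 0 = rho)
  by (unfold const_b; rewrite Vt, Vy, HE; field).
assert (Hc : const_c gamma 0 = l) by exact Vz.
split; [|split].
- assert (H := metric_norm_squares omega gamma 0).
  rewrite Ha, Hb, Hc, Vx, HE in H.
  replace ((rho / (rho / 2)) ^ 2) with 4 in H by (field; lra).
  replace (2 * (1 * rho) / (rho / 2)) with 4 in H by (field; lra).
  nra.
- rewrite Ha, Hb; lra.
- unfold impact, const_Y; rewrite Ha, Hb, Hc, Vx.
  change (pt_y (gamma 0)) with (Y - sqrt 2 * v / (omega * rho)).
  apply f_equal2; [apply f_equal2|]; field; lra.
Qed.

(** The action must be a function of [F] alone, while [L] is only known to exist in [Prop]; it is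
    therefore read off from the image of one test curve. *)
Definition ray_action (omega : R) (F : point -> point) (beta : R * R * R) : R * R * R :=
  impact omega (fun s => F (ray_line omega beta s)) 0.

Lemma ray_actionE omega F L l rho Y : 0 < omega -> moment_action omega F L ->
  boundary (l, rho, Y) ->
  ray_action omega F (l, rho, Y) =
  ray_of_moments omega l (L (moments_of_ray omega (l, rho, Y))).
Proof.
intros Hw HF Hb.
destruct (ray_line_impact omega _ Hw Hb) as (H1 & H2 & H3); unfold ray_action.
rewrite (impact_image omega F L m_infty p_infty (ray_line omega (l, rho, Y)) 0
  Hw HF (ray_line_smooth omega _)), H3; auto; [|split; exact I].
injection H3; intros _ _ ->; reflexivity.
Qed.

Lemma moment_action_ray omega F L l rho Y : 0 < omega -> moment_action omega F L ->
  0 < rho ->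
  let v := L (moments_of_ray omega (l, rho, Y)) in
  0 < fst (fst v) /\ discriminant v = 2 * (1 + l ^ 2).
Proof.
intros Hw (_ & L2 & L3 & _) Hr v; unfold v; clear v.
assert (Hd := discriminant_moments_of_ray omega l rho Y Hr).
split; [|rewrite L2; exact Hd].
apply L3; [exact Hr|]; rewrite Hd; assert (H := pow2_ge_0 l); lra.
Qed.

Lemma ray_action_boundary omega F L beta : 0 < omega -> moment_action omega F L ->
  boundary beta -> boundary (ray_action omega F beta).
Proof.
intros Hw HF; destruct beta as [[l rho] Y]; intros Hb.
rewrite (ray_actionE omega F L) by auto; destruct Hb as [Hl Hr].
destruct (moment_action_ray omega F L l rho Y Hw HF Hr) as [Hv _].
destruct (L _) as [[b m] g]; split; assumption.
Qed.

(** Passing through impact parameters loses nothing: the intermediate moments have [b > 0] and the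
    normalised discriminant, so [ray_of_momentsK] recovers them. *)
Lemma ray_action_comp omega F G LF LG beta : 0 < omega ->
  moment_action omega F LF -> moment_action omega G LG -> boundary beta ->
  ray_action omega (fun p => F (G p)) beta = ray_action omega F (ray_action omega G beta).
Proof.
intros Hw HF HG; destruct beta as [[l rho] Y]; intros Hb.
assert (Hb' := ray_action_boundary omega G LG _ Hw HG Hb).
rewrite (ray_actionE omega _ _ _ _ _ Hw (moment_action_comp omega F G LF LG HF HG) Hb).
rewrite (ray_actionE omega G LG) in * by auto.
destruct (moment_action_ray omega G LG l rho Y Hw HG (proj2 Hb)) as [Hv Hd].
set (v := LG _) in *.
assert (HK := ray_of_momentsK omega l v Hw Hv Hd).
destruct v as [[b m] g]; unfold ray_of_moments in HK, Hb' |- * at 2.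
rewrite (ray_actionE omega F LF), HK by auto; reflexivity.
Qed.

(** * Lightlike geodesics and their images *)

Lemma lightlike_boundary omega lo hi gamma s :
  lightlike_geodesic omega lo hi gamma -> in_itv lo hi s ->
  0 < const_a omega gamma s * const_b omega gamma s /\ boundary (impact omega gamma s).
Proof.
intros (Hg & Hnull & s1 & s2 & Hs1 & Hs2 & Hne) Hs.
assert (Hge := proj1 (geodesicE omega lo hi gamma) Hg).
destruct Hge as (_ & Hsm & Hcst).
assert (Hsq : forall s', in_itv lo hi s' ->
  let a := const_a omega gamma s' in
  let e := const_b omega gamma s' / expx omega (gamma s') in
  a ^ 2 + const_c gamma s' ^ 2 + vel gamma Ix s' ^ 2 + e ^ 2 / 2 = 2 * (a * e)).
{ intros s' Hs'; simpl.
  assert (H := metric_norm_squares omega gamma s').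
  unfold metric_norm in H; rewrite (Hnull s' Hs') in H.
  unfold Rdiv in *; lra. }
assert (HE := expx_pos omega (gamma s)).
assert (Hab : 0 < const_a omega gamma s * const_b omega gamma s).
(* If [a * b <= 0], the sum of squares forces [a = b = c = 0] at [s], hence along the whole
   geodesic. All velocities then vanish and [gamma] is constant, against [Hne]. *)
{ apply Rnot_le_lt; intros Hle; apply Hne.
  assert (H := Hsq s Hs); simpl in H.
  set (a := const_a omega gamma s) in *; set (c := const_c gamma s) in *.
  set (e := const_b omega gamma s / expx omega (gamma s)) in *.
  assert (Hb : const_b omega gamma s = e * expx omega (gamma s)) by (unfold e; field; lra).
  assert (Hae : a * e <= 0).
  { rewrite Hb in Hle; apply (Rmult_le_reg_r (expx omega (gamma s))); lra. }
  assert (Ha0 : a = 0) by nra.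
  assert (Hc0 : c = 0) by nra.
  assert (He0 : e = 0) by nra.
  assert (Hb0 : const_b omega gamma s = 0) by (rewrite Hb, He0; ring).
  assert (Hv : forall i s', in_itv lo hi s' -> vel gamma i s' = 0).
  { intros i s' Hs'; destruct (Hcst s' s Hs' Hs) as (C1 & C2 & C3).
    injection C3; intros _ _ C4.
    fold a in C1; fold c in C2; rewrite Ha0 in C1; rewrite Hc0 in C2; rewrite Hb0 in C4.
    assert (H' := Hsq s' Hs'); simpl in H'; rewrite C1, C2, C4 in H'.
    assert (HE' := expx_pos omega (gamma s')).
    unfold const_a in C1; unfold const_b in C4.
    replace (0 / expx omega (gamma s')) with 0 in H' by (field; lra).
    set (E := expx omega (gamma s')) in *.
    assert (Hsum : 2 * vel gamma It s' + E * vel gamma Iy s' = 0)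
      by (apply (Rmult_eq_reg_l E); lra).
    assert (Hy : vel gamma Iy s' = 0) by (apply (Rmult_eq_reg_l E); lra).
    destruct i; [lra | nra | exact Hy | exact C2]. }
  assert (Hco : forall i, coord i (gamma s1) = coord i (gamma s2)).
  { intros i; apply (null_derivative_itv lo hi (fun s' => coord i (gamma s'))); auto.
    intros s' Hs'; rewrite <- (Hv i s' Hs'); apply Derive_correct, (Hsm i s' Hs'). }
  assert (H1 := Hco It); assert (H2 := Hco Ix); assert (H3 := Hco Iy); assert (H4 := Hco Iz).
  destruct (gamma s1), (gamma s2); simpl in *; congruence. }
split; [exact Hab|].
assert (H := Hsq s Hs); simpl in H.
set (e := const_b omega gamma s / expx omega (gamma s)) in *.
unfold impact, boundary.
set (a := const_a omega gamma s) in *; set (b := const_b omega gamma s) in *.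
set (c := const_c gamma s) in *.
assert (Ha0 : a <> 0) by (intros H0; rewrite H0 in Hab; lra).
assert (Ha2 : 0 < a ^ 2) by (apply pow2_gt_0, Ha0).
assert (Hi : 0 < / a ^ 2) by (apply Rinv_0_lt_compat, Ha2).
split.
(* Completing the square in [Hsq] gives [c ^ 2 + x' ^ 2 + (2 * a - e) ^ 2 / 2 = a ^ 2], with [x']
   the velocity in [x]. *)
- assert (Hc : c ^ 2 <= a ^ 2) by (assert (Hx := pow2_ge_0 (2 * a - e)); nra).
  assert (Hl : (c / a) ^ 2 <= 1).
  { replace ((c / a) ^ 2) with (c ^ 2 * / a ^ 2) by (field; auto).
    replace 1 with (a ^ 2 * / a ^ 2) by (field; auto).
    apply Rmult_le_compat_r; lra. }
  nra.
- replace (b / a) with (a * b * / a ^ 2) by (field; auto).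
  apply Rmult_lt_0_compat; assumption.
Qed.

Lemma lightlike_image omega F G LF lo hi gamma :
  moment_action omega F LF -> (forall p, G (F p) = p) ->
  lightlike_geodesic omega lo hi gamma ->
  lightlike_geodesic omega lo hi (fun s => F (gamma s)).
Proof.
intros (_ & L2 & _ & HF) HG (Hg & Hnull & s1 & s2 & Hs1 & Hs2 & Hne).
apply geodesicE in Hg; destruct Hg as (Hlt & Hsm & Hc).
destruct (HF lo hi gamma Hsm) as [Hsm' Hm].
split; [|split].
- apply geodesicE; split; [exact Hlt|]; split; [exact Hsm'|].
  intros r1 r2 H1 H2.
  destruct (Hc r1 r2 H1 H2) as (C1 & C2 & C3).
  destruct (Hm r1 H1) as (A1 & A2 & A3), (Hm r2 H2) as (B1 & B2 & B3).
  rewrite A1, A2, A3, B1, B2, B3, C1, C2, C3; auto.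
- intros s Hs; change (metric_norm omega (fun s' => F (gamma s')) s = 0).
  destruct (Hm s Hs) as (A1 & A2 & A3).
  rewrite metric_norm_moments, A1, A2, A3, L2, <- metric_norm_moments.
  apply Hnull, Hs.
- exists s1, s2; split; [exact Hs1|]; split; [exact Hs2|].
  intros H; apply Hne; rewrite <- (HG (gamma s1)), H; apply HG.
Qed.

(** * The rotation formula and the conclusion *)

(** The normalised moments have half-sum [al], half-difference [rho - al] and middle entry
    [omega * rho * Y]; the rotation fixes the first and turns the other two. *)
Lemma rotation_ray omega th l rho Y : 0 < omega -> 0 < rho ->
  let al := boundary_alpha omega l rho Y in
  let rho' := al + (rho - al) * cos th - omega * rho * Y * sin th in
  ray_of_moments omega l (rotation_moments th (moments_of_ray omega (l, rho, Y))) =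
  (l, rho', (omega * rho * Y * cos th + (rho - al) * sin th) / (omega * rho')).
Proof.
intros Hw Hr al rho'.
unfold rotation_moments, moments_of_ray.
set (g := ((omega * rho * Y) ^ 2 + 2 * (1 + l ^ 2)) / rho).
assert (Hal : (rho + g) / 2 = al) by (unfold al, boundary_alpha, g; field; lra).
assert (Hd : (rho - g) / 2 = rho - al) by (rewrite <- Hal; field).
rewrite Hal, Hd; unfold ray_of_moments.
assert (Hr' : al + ((rho - al) * cos th - omega * rho * Y * sin th) = rho')
  by (unfold rho'; ring).
rewrite Hr'; apply f_equal2; [reflexivity|].
f_equal; ring.
Qed.

Theorem proposition3 (omega : R) (Homega : 0 < omega) :
  (exists act : (point -> point) -> R * R * R -> R * R * R,
    (* act is an action of the isometry group on the boundary *)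
    (forall F beta, isometry_group omega F -> boundary beta ->
       boundary (act F beta)) /\
    (forall beta, boundary beta -> act (fun p => p) beta = beta) /\
    (forall F G beta, isometry_group omega F -> isometry_group omega G ->
       boundary beta ->
       act (fun p => F (G p)) beta = act F (act G beta)) /\
    (* it describes the images of lightlike geodesics *)
    (forall F (lo hi : Rbar) (gamma : R -> point) beta,
       isometry_group omega F ->
       lightlike_geodesic omega lo hi gamma ->
       impact_parameter omega lo hi gamma beta ->
       lightlike_geodesic omega lo hi (fun s => F (gamma s)) /\
       impact_parameter omega lo hi (fun s => F (gamma s)) (act F beta)) /\
    (* 1) *)
    (forall t0 y0 z0 l rho Y, boundary (l, rho, Y) ->
       act (translation t0 y0 z0) (l, rho, Y) = (l, rho, Y + y0)) /\
    (* 2) *)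
    (forall x0 l rho Y, boundary (l, rho, Y) ->
       act (dilatation omega x0) (l, rho, Y) =
       (l, rho * exp (sqrt 2 * omega * x0), Y * exp (- (sqrt 2 * omega * x0)))) /\
    (* 3) *)
    (forall phi0 F l rho Y, is_rotation omega phi0 F -> boundary (l, rho, Y) ->
       let al := boundary_alpha omega l rho Y in
       act F (l, rho, Y) =
       (l,
        al + (rho - al) * cos (omega * phi0) - omega * rho * Y * sin (omega * phi0),
        (omega * rho * Y * cos (omega * phi0) + (rho - al) * sin (omega * phi0)) /
        (omega * (al + (rho - al) * cos (omega * phi0)
                  - omega * rho * Y * sin (omega * phi0)))))) /\
  (* alpha is constant under phi |-> phi + phi0 *)
  (forall phi0 F (lo hi : Rbar) (gamma : R -> point) (u r phi : R -> R) s,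
     is_rotation omega phi0 F ->
     geodesic omega lo hi gamma -> in_itv lo hi s ->
     const_a omega gamma s <> 0 ->
     polar_lift_at omega gamma u r phi s ->
     alpha omega (fun s' => F (gamma s')) u r (fun s' => phi s' + phi0) s =
     alpha omega gamma u r phi s) /\
  (* alpha is constant along each geodesic *)
  (forall (lo hi : Rbar) (gamma : R -> point) (u r phi : R -> R) s1 s2,
     geodesic omega lo hi gamma -> in_itv lo hi s1 -> in_itv lo hi s2 ->
     const_a omega gamma s1 <> 0 ->
     polar_lift_at omega gamma u r phi s1 ->
     polar_lift_at omega gamma u r phi s2 ->
     alpha omega gamma u r phi s1 = alpha omega gamma u r phi s2) /\
  (* value of alpha on a lightlike geodesic *)
  (forall (lo hi : Rbar) (gamma : R -> point) (u r phi : R -> R) l rho Y s,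
     lightlike_geodesic omega lo hi gamma ->
     impact_parameter omega lo hi gamma (l, rho, Y) ->
     in_itv lo hi s ->
     polar_lift_at omega gamma u r phi s ->
     alpha omega gamma u r phi s = boundary_alpha omega l rho Y).
Proof.
assert (Haction : forall F, isometry_group omega F -> exists G L, moment_action omega F L /\
  forall p, G (F p) = p).
{ intros F HF; destruct (isometry_moment_action omega F Homega HF)
    as (G & L & _ & H1 & _ & _ & H2); eauto. }
assert (Hrot : forall phi0 F, is_rotation omega phi0 F ->
    moment_action omega F (rotation_moments (omega * phi0))).
{ intros phi0 F HF; rewrite (is_rotationE omega phi0 F Homega HF).
  apply rotation_moment_action, Homega. }
split; [exists (ray_action omega); repeat match goal with |- _ /\ _ => split end|].
- intros F beta HF Hb; destruct (Haction F HF) as (_ & L & HL & _).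
  apply (ray_action_boundary omega F L); assumption.
- intros [[l rho] Y] Hb.
  rewrite (ray_actionE omega _ _ _ _ _ Homega (moment_action_id omega) Hb).
  apply moments_of_rayK; [exact Homega | apply Hb].
- intros F G beta HF HG Hb.
  destruct (Haction F HF) as (_ & LF & HLF & _), (Haction G HG) as (_ & LG & HLG & _).
  apply (ray_action_comp omega F G LF LG); assumption.
- intros F lo hi gamma beta HF Hg Himp.
  destruct (Haction F HF) as (G & L & HL & HG).
  split; [apply (lightlike_image omega F G L); assumption|].
  intros s Hs; change (ray_action omega F beta = impact omega (fun s' => F (gamma s')) s).
  rewrite (Himp s Hs); fold (impact omega gamma s).
  destruct (lightlike_boundary omega lo hi gamma s Hg Hs) as [Hab Hb].
  destruct Hg as (Hg & Hnull & _); apply geodesicE in Hg; destruct Hg as (_ & Hsm & _).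
  (* The geodesic and the test curve have the same impact parameter, so both images are computed by
     the same [L]. *)
  rewrite (impact_image omega F L lo hi gamma s Homega HL Hsm Hs (Hnull s Hs) Hab).
  apply (ray_actionE omega F L); assumption.
- intros t0 y0 z0 l rho Y Hb.
  rewrite (ray_actionE omega _ _ _ _ _ Homega (translation_moment_action omega t0 y0 z0) Hb).
  destruct Hb as [_ Hr]; unfold ray_of_moments, translation_moments, moments_of_ray.
  apply f_equal2; [reflexivity|]; field; lra.
- intros x0 l rho Y Hb.
  rewrite (ray_actionE omega _ _ _ _ _ Homega (dilatation_moment_action omega x0) Hb).
  destruct Hb as [_ Hr]; unfold ray_of_moments, dilatation_moments, moments_of_ray.
  rewrite exp_Ropp; assert (Hk := exp_pos (sqrt 2 * omega * x0)).
  apply f_equal2; [apply f_equal2|]; try field; lra.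
- intros phi0 F l rho Y HF Hb.
  rewrite (ray_actionE omega _ _ _ _ _ Homega (Hrot phi0 F HF) Hb).
  apply rotation_ray; [exact Homega | apply Hb].
- split; [|split].
  + intros phi0 F lo hi gamma u r phi s HF Hg Hs _ Hl.
    apply geodesicE in Hg; destruct Hg as (_ & Hsm & _).
    destruct (Hrot phi0 F HF) as (_ & _ & _ & HL).
    destruct (HL lo hi gamma Hsm) as [Hsm' Hm]; destruct (Hm s Hs) as [Ha _].
    (* Apart from [a], which [F] preserves, [alpha] involves only [r] and the derivatives of [u] and
       [phi], which a shift of [phi] by a constant leaves unchanged. *)
    unfold alpha; rewrite Ha.
    assert (Hphi : Derive (fun s' => phi s' + phi0) s = Derive phi s).
    { destruct Hl as (_ & _ & _ & Hphi).
      apply is_derive_unique; auto_derive; [exact Hphi | apply Rmult_1_l]. }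
    rewrite Hphi; reflexivity.
  + intros lo hi gamma u r phi s1 s2 Hg Hs1 Hs2 _ Hl1 Hl2.
    apply geodesicE in Hg; destruct Hg as (_ & Hsm & Hc).
    rewrite !(alpha_moments omega lo hi) by assumption.
    destruct (Hc s1 s2 Hs1 Hs2) as (Ha & _ & Hm); injection Hm; intros Hgg _ Hb.
    rewrite Ha, Hb, Hgg; reflexivity.
  + intros lo hi gamma u r phi l rho Y s Hg Himp Hs Hl.
    destruct (lightlike_boundary omega lo hi gamma s Hg Hs) as [Hab Hb].
    destruct Hg as (Hg & Hnull & _); apply geodesicE in Hg; destruct Hg as (_ & Hsm & _).
    rewrite (alpha_moments omega lo hi) by assumption.
    assert (Hm := moments_of_impact omega gamma s Homega (Hnull s Hs) Hab).
    assert (Hi : impact omega gamma s = (l, rho, Y)) by (symmetry; apply Himp, Hs).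
    rewrite Hi in Hm, Hb; destruct Hb as [_ Hr]; injection Hm; intros Hgg _ Hbb.
    rewrite Hgg, Hbb; unfold boundary_alpha; field.
    split; [lra|]; intros Ha0; rewrite Ha0 in Hab; lra.
Qed.
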